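(* Let $n\ge 6$ be an integer and let $p,q\ge 3$ be two integers satisfying $n=p+q$. For any spatial embedding $f$ of the complete graph $K_n$, we have $$\max_{\lambda\in\Gamma_{p,q}(K_n)}\left|\mathrm{lk}(f(\lambda))\right|\ \ge\ \frac{\sqrt{pq}}{3\sqrt{10}}.$$
   Context: We work in the piecewise linear category. $K_n$ is the complete graph on the $n$ vertices $1,\dots,n$. A spatial embedding of a finite graph $G$ is a (piecewise linear) embedding $f$ of $G$ into $\mathbb{R}^3$. A cycle of $G$ is a subgraph homeomorphic to a circle; a $p$-cycle is a cycle with exactly $p$ edges. $\Gamma_{p,q}(G)$ denotes the set of all unordered pairs $\lambda=\gamma\cup\gamma'$ of two (vertex-)disjoint cycles of $G$ consisting of a $p$-cycle and a $q$-cycle. For such $\lambda$, $f(\lambda)$ is a 2-component link and $\mathrm{lk}(f(\lambda))$ is its linking number; it is defined up to sign unless the components are oriented, so $|\mathrm{lk}(f(\lambda))|$ is well defined. *)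

(* Defs.v *)
From HB Require Import structures.
From mathcomp Require Import all_boot all_order all_algebra.
From mathcomp Require Import all_classical all_reals.

Set Implicit Arguments.
Unset Strict Implicit.
Unset Printing Implicit Defensive.
Import Order.TTheory GRing.Theory Num.Theory.
Local Open Scope ring_scope.

Section PolygonalCurves.
Variable R : realType.
Local Notation R3 := 'rV[R]_3.

Definition seg (a b : R3) (t : R) : R3 := (1 - t) *: a + t *: b.

Definition det3 (u v w : R3) : R := \det (\matrix_(i < 3) nth 0 [:: u; v; w] i).

(* Piecewise linear path through the points of s, parametrised by
   [0, size s - 1] and passing through the i-th point at time i. *)
Definition polypath (s : seq R3) (r : R) : R3 :=
  let i := Num.truncn r in seg (nth 0 s i) (nth 0 s i.+1) (r - i%:R).

Definition polytime (s : seq R3) : interval R := `[0, (size s).-1%:R].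

(* A sequence of points also stands for an oriented closed polygon; its sides
   include the one from the last point back to the first. *)
Definition sides (P : seq R3) : seq (R3 * R3) := zip P (rot 1 P).

(* The linking number is read off the diagram obtained by projecting the two
   polygons along a direction u.  Only crossings between the two components
   count, so only these are required to be regular: they avoid the vertices and
   are transverse. *)
Definition regular_direction (P Q : seq R3) (u : R3) : Prop :=
  u != 0 /\
  forall a b c d (s t h : R),
    (a, b) \in sides P -> (c, d) \in sides Q ->
    0 <= s <= 1 -> 0 <= t <= 1 -> seg a b s - seg c d t = h *: u ->
    [/\ 0 < s < 1, 0 < t < 1 & det3 (b - a) (d - c) u != 0].

Definition crossing (u : R3) (x y : R3 * R3) : Prop :=
  exists s t h : R, [/\ 0 <= s <= 1, 0 <= t <= 1
                      & seg x.1 x.2 s - seg y.1 y.2 t = h *: u].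

(* Sign of the crossing of the sides x and y.  With u pointing to the viewer, it
   is the sign of det (o, w, u), where o and w are the directions of the over-
   and the understrand.  If the crossing points are X on x and Y on y, with
   X - Y = h u, then x is over iff 0 < h; in either case the sign equals that of
   det (x.2 - x.1, y.2 - y.1, X - Y), in which X - Y may be replaced by
   x.1 - y.1, as they differ by a combination of the first two vectors. *)
Definition crossing_sign (x y : R3 * R3) : R :=
  Num.sg (det3 (x.2 - x.1) (y.2 - y.1) (x.1 - y.1)).

Definition diagram_lk (u : R3) (P Q : seq R3) : R :=
  2^-1 * \sum_(x <- sides P) \sum_(y <- sides Q)
            (if `[< crossing u x y >] then crossing_sign x y else 0).

(* The value does not depend on the regular direction that is chosen. *)
Definition linking_number (P Q : seq R3) : R :=
  diagram_lk (xget 0 (regular_direction P Q)) P Q.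

End PolygonalCurves.

(* A finite simple graph is a finite type V with a symmetric irreflexive
   relation g on V. *)
Section SpatialGraphs.
Variables (R : realType) (V : finType) (g : rel V).
Local Notation R3 := 'rV[R]_3.

Definition edge_points (pos : V -> R3) (bends : V -> V -> seq R3) (x y : V) :
  seq R3 := pos x :: rcons (bends x y) (pos y).

(* A piecewise linear map on g is affine on each edge of some subdivision of g.
   It is given by the images of the vertices of g and, along each edge from x to
   y, the images bends x y of the subdivision points in order.  The last four
   fields express that the map is injective. *)
Record spatial_embedding := SpatialEmbedding {
  pos : V -> R3;
  bends : V -> V -> seq R3;
  bends_sym : forall x y, g x y -> bends y x = rev (bends x y);
  pos_inj : injective pos;
  edge_inj : forall x y, g x y ->
    let s := edge_points pos bends x y in
    {in polytime s &, injective (polypath s)};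
  edge_vertex : forall x y z r, g x y ->
    let s := edge_points pos bends x y in
    r \in polytime s -> polypath s r = pos z -> z \in [:: x; y];
  edge_edge : forall x y z w r r', g x y -> g z w ->
    ~~ perm_eq [:: x; y] [:: z; w] ->
    let s := edge_points pos bends x y in
    let s' := edge_points pos bends z w in
    r \in polytime s -> r' \in polytime s' -> polypath s r = polypath s' r' ->
    exists v, [/\ v \in [:: x; y], v \in [:: z; w] & polypath s r = pos v]
}.

(* A cycle is given by the cyclic sequence of its vertices, i.e. together with
   an orientation and a starting vertex. *)
Definition is_cycle (c : seq V) : bool :=
  [&& (2 < size c)%N, cycle g c & uniq c].

(* Disjoint pairs of a p-cycle and a q-cycle; an unordered pair of unoriented
   cycles is represented several times, with the same |lk|. *)
Definition Gamma (p q : nat) : {set p.-tuple V * q.-tuple V} :=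
  finset (fun l : p.-tuple V * q.-tuple V =>
    [&& is_cycle l.1, is_cycle l.2 & [disjoint l.1 & l.2]]).

Definition cycle_image (f : spatial_embedding) (c : seq V) : seq R3 :=
  flatten [seq pos f x :: bends f x (next c x) | x <- c].

Definition lk (f : spatial_embedding) (c c' : seq V) : R :=
  linking_number (cycle_image f c) (cycle_image f c').

End SpatialGraphs.

Definition complete_graph (n : nat) : rel 'I_n := fun x y => x != y.

(* Main.v *)
Require Import Defs.
From mathcomp Require Import all_boot all_order all_fingroup all_algebra.
From mathcomp Require Import all_classical all_reals.
From mathcomp Require Import ring lra zify.
Import Order.TTheory GRing.Theory Num.Theory.
Local Open Scope ring_scope.
Set Implicit Arguments.
Unset Strict Implicit.
Unset Printing Implicit Defensive.

(** Apply a uniformly random permutation of the n vertices to a fixed disjoint pair of a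
    p-cycle and a q-cycle.  The expected square of the linking number of the resulting pair
    is at least p q / 90, so that some pair reaches the square root of this number, which is
    the asserted bound.  Three facts combine.

    Linking is a sum over pairs of edges.  Up to one global sign, the linking number of two
    disjoint cycles is the sum, over an edge of the first and an edge of the second, of an
    integer [edge_link] that changes sign when one of the edges is reversed
    ([lk_edge_link]).  As each linking number is read off a diagram in a direction that
    depends on the two polygons P and Q, this rests on the independence of the direction.  To
    see it, lift all points to homogeneous coordinates and move them infinitesimally in the
    directions of points of the moment curve, over the polynomials ordered with ['X]
    infinitesimal.  Then all determinants are
    nonzero and every count below is a function of their signs.  A direction becomes an apex
    at infinity, and the crossings at which Q is in front of P are the intersections of Q
    with the cone over P.  Their algebraic number is the same for all apices, as tetrahedra
    have closed boundaries ([link_apex]); the apices u and - u give the two kinds of crossings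
    of the diagram ([diagram_chain_link]).

    Second moments are proportional to lengths.  Expand the square of the double sum over
    edges and average over the permutations.  Two disjoint edges of the same cycle have
    correlation zero, because exchanging the ends of one of them changes the sign.  Equal and
    consecutive edges have correlations that do not depend on the length of the cycle
    ([second_moment]).  So the second moment for (p, q) is p q / 9 times the one for (3, 3)
    ([cycles_vs_triangles]).

    Triangles are linked often.  For the ten splittings of six vertices into two triangles,
    the sum of the linking numbers is odd ([trilinks_sum_odd], the theorem of Conway, Gordon
    and Sachs).  One of the ten is therefore nonzero, and the second moment for (3, 3) is at
    least 1 / 10 ([triangle_moment]).  The parity is that of the number of crossings of
    disjoint edges in a plane drawing of the complete graph on five vertices
    ([ten_triangle_pairs]).  Straightening an edge changes it by the crossings of a closed
    curve with a closed triangle, an even number ([deviation_cocycle]); for straight edges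
    it is odd by an inspection of all sign patterns ([pentagon_crossings]). *)

(** * Signs of polynomials at an infinitesimal *)

Section InfinitesimalSign.
Variable R : realFieldType.
Implicit Types p q r : {poly R}.

(** The sign of [low_coef p] is the sign of [p] at all sufficiently small positive
    reals: [ipos] orders the polynomials with ['X] a positive infinitesimal. *)
Definition low_coef p : R := p`_(find (fun c => c != 0) p).
Definition ipos p : bool := 0 < low_coef p.

Lemma low_coefMXn q k : q`_0 != 0 -> low_coef (q * 'X^k) = q`_0.
Proof.
move=> q0; have qn0 : q != 0 by apply: contra_neq q0 => ->; rewrite coef0.
rewrite /low_coef coefMXn.
have -> : find (fun c : R => c != 0) (q * 'X^k) = k.
  rewrite polyseqMXn //.
  elim: k => [|k IH] /=; last by rewrite eqxx /= IH.
  by rewrite /ncons /=; move: q0; case: (polyseq q) => [|a s] /=; rewrite ?eqxx // => ->.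
by rewrite ltnn subnn.
Qed.

Lemma low_coef0 : low_coef 0 = 0.
Proof. by rewrite /low_coef coef0. Qed.

(** Every statement about the lowest coefficient reduces, through this factorization,
    to one about constant coefficients. *)
Lemma factor_lowest p : p != 0 -> exists q k, q`_0 != 0 /\ p = q * 'X^k.
Proof.
elim/poly_ind: p => [|p c IH]; first by rewrite eqxx.
have [->|c0] := eqVneq c 0; last first.
  by move=> _; exists (p * 'X + c%:P), 0%N; rewrite expr0 mulr1 coefD coefMX coefC add0r.
rewrite addr0 => pX; have /IH[q [k [q0 ->]]] : p != 0.
  by apply: contra_neq pX => ->; rewrite mul0r.
by exists q, k.+1; rewrite exprSr mulrA.
Qed.

Lemma low_coef_eq0 p : (low_coef p == 0) = (p == 0).
Proof.
have [->|/factor_lowest[q [k [q0 ->]]]] := eqVneq p 0; first by rewrite low_coef0 eqxx.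
by rewrite low_coefMXn // (negbTE q0).
Qed.

Lemma low_coef_coef0 p : p`_0 != 0 -> low_coef p = p`_0.
Proof. by move=> p0; rewrite -[p in LHS]mulr1 -(expr0 'X) low_coefMXn. Qed.

Lemma low_coefM p q : low_coef (p * q) = low_coef p * low_coef q.
Proof.
have [->|/factor_lowest[a [i [a0 ->]]]] := eqVneq p 0.
  by rewrite mul0r low_coef0 mul0r.
have [->|/factor_lowest[b [j [b0 ->]]]] := eqVneq q 0.
  by rewrite mulr0 low_coef0 mulr0.
rewrite mulrACA -exprD !low_coefMXn // ?coef0M //; exact: mulf_neq0.
Qed.

Lemma low_coefN p : low_coef (- p) = - low_coef p.
Proof.
have [->|/factor_lowest[a [i [a0 ->]]]] := eqVneq p 0.
  by rewrite oppr0 low_coef0 oppr0.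
by rewrite -mulNr !low_coefMXn // coefN ?oppr_eq0.
Qed.

Lemma iposN p : p != 0 -> ipos (- p) = ~~ ipos p.
Proof.
by rewrite -low_coef_eq0 /ipos low_coefN oppr_gt0 -leNgt [in RHS]le_eqVlt => /negbTE->.
Qed.

Lemma iposM p q : p != 0 -> q != 0 -> ipos (p * q) = (ipos p == ipos q).
Proof.
rewrite -!low_coef_eq0 /ipos low_coefM => p0 q0.
case: (ltgtP 0 (low_coef p)) p0 => [h _|h _|//].
  by rewrite pmulr_rgt0.
by rewrite nmulr_rgt0 // [RHS]eq_sym eqbF_neg -leNgt le_eqVlt (negbTE q0).
Qed.

Lemma iposD p q : ipos p -> ipos q -> ipos (p + q).
Proof.
have pos_factor r : ipos r -> exists (a : {poly R}) i, 0 < a`_0 /\ r = a * 'X^i.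
  rewrite /ipos => r0; have rn0 : r != 0 by rewrite -low_coef_eq0 gt_eqF.
  have [a [i [a0 E]]] := factor_lowest rn0; exists a, i; split=> //.
  by rewrite E low_coefMXn in r0.
move=> /pos_factor[a [i [a0 ->]]] /pos_factor[b [j [b0 ->]]].
(* Factor out the lower power: the other term, if its power is higher, does not
   reach the constant coefficient. *)
wlog ij : a b i j a0 b0 / (i <= j)%N.
  move=> W; have [ij|/ltnW ij] := leqP i j; first exact: W.
  by rewrite addrC; apply: W.
rewrite -(subnK ij) exprD mulrA -mulrDl; set c := a + _.
have c0 : 0 < c`_0.
  rewrite /c coefD coefMXn; case: (j - i)%N => [|n] /=; last by rewrite addr0.
  by rewrite subnn addr_gt0.
by rewrite /ipos low_coefMXn // gt_eqF.
Qed.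

Lemma ipos_coef_sign p k : (forall j, (j < k)%N -> p`_j = 0) ->
  if ipos p then 0 <= p`_k else p`_k <= 0.
Proof.
move=> lo; have [->|pk] := eqVneq p`_k 0; first by case: ifP.
suff E : low_coef p = p`_k by rewrite /ipos E; case: ltP => [/ltW|].
rewrite /low_coef; case: (ltngtP (find (fun c => c != 0) p) k) => [h||-> //].
  have := lo _ h; move/eqP; rewrite -/(low_coef p) low_coef_eq0 => /eqP p0.
  by rewrite p0 coef0 eqxx in pk.
by move/(before_find 0); rewrite pk.
Qed.

(** A relation between polynomials, read at the first degree in which one of the
    coefficients is nonzero, only involves the constant terms of the other factors. *)
Lemma coefM_lowest p q k : (forall j, (j < k)%N -> p`_j = 0) -> (p * q)`_k = p`_k * q`_0.
Proof.
move=> lo; rewrite coefM big_ord_recr /= subnn big1 ?add0r // => i _.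
by rewrite lo ?mul0r.
Qed.

End InfinitesimalSign.

(** * Orientations of vectors in dimension four *)

Section Vectors.
Variable A : comNzRingType.
Definition vec4 := (A * A * A * A)%type.
Implicit Types x y z w : vec4.

Definition det4 x y z w : A :=
  let: (x1, x2, x3, x4) := x in let: (y1, y2, y3, y4) := y in
  let: (z1, z2, z3, z4) := z in let: (w1, w2, w3, w4) := w in
  (x1 * y2 - x2 * y1) * (z3 * w4 - z4 * w3)
  - (x1 * y3 - x3 * y1) * (z2 * w4 - z4 * w2)
  + (x1 * y4 - x4 * y1) * (z2 * w3 - z3 * w2)
  + (x2 * y3 - x3 * y2) * (z1 * w4 - z4 * w1)
  - (x2 * y4 - x4 * y2) * (z1 * w3 - z3 * w1)
  + (x3 * y4 - x4 * y3) * (z1 * w2 - z2 * w1).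

Definition opp4 x : vec4 := let: (x1, x2, x3, x4) := x in (- x1, - x2, - x3, - x4).
(** Points of the moment curve: any four of them are linearly independent, which makes
    them universal directions of perturbation. *)
Definition moment4 (k : A) : vec4 := (1, k, k ^+ 2, k ^+ 3).
Definition lin4 (t : A) x y : vec4 :=
  let: (x1, x2, x3, x4) := x in let: (y1, y2, y3, y4) := y in
  (x1 + t * y1, x2 + t * y2, x3 + t * y3, x4 + t * y4).

End Vectors.

Ltac det4_ring :=
  repeat (match goal with x : vec4 _ |- _ => destruct x as [[[? ?] ?] ?] end);
  rewrite /det4 /=; ring.

(** The relations of Grassmann and Pluecker for six vectors, one for each pair among
    the first five.  On signs, they are all that is needed of the geometry below. *)
Lemma grassmann_plucker (A : comNzRingType) (o p a b c d : vec4 A) :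
  det4 o p a b * det4 o p c d - det4 o p a c * det4 o p b d + det4 o p a d * det4 o p b c = 0 /\
  det4 o p a b * det4 o a c d - det4 o p a c * det4 o a b d + det4 o p a d * det4 o a b c = 0 /\
  det4 o p a b * det4 o b c d - det4 o p b c * det4 o a b d + det4 o p b d * det4 o a b c = 0 /\
  det4 o p a c * det4 o b c d - det4 o p b c * det4 o a c d + det4 o p c d * det4 o a b c = 0 /\
  det4 o p a b * det4 p a c d - det4 o p a c * det4 p a b d + det4 o p a d * det4 p a b c = 0 /\
  det4 o p a b * det4 p b c d - det4 o p b c * det4 p a b d + det4 o p b d * det4 p a b c = 0 /\
  det4 o p a c * det4 p b c d - det4 o p b c * det4 p a c d + det4 o p c d * det4 p a b c = 0 /\
  det4 o p a b * det4 a b c d - det4 o a b c * det4 p a b d + det4 o a b d * det4 p a b c = 0 /\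
  det4 o p a c * det4 a b c d - det4 o a b c * det4 p a c d + det4 o a c d * det4 p a b c = 0 /\
  det4 o p b c * det4 a b c d - det4 o a b c * det4 p b c d + det4 o b c d * det4 p a b c = 0.
Proof. by do 9 (split; first det4_ring); det4_ring. Qed.

Definition common_sign (s t1 t2 t3 t4 : bool) : int :=
  if [&& s == t1, s == t2, s == t3 & s == t4] then if s then 1 else -1 else 0.

(** The three products of a Pluecker relation sum to zero, so that they do not all
    have the same sign. *)
Definition plucker_signs (x1 x2 y1 y2 z1 z2 : bool) :=
  ~~ (((x1 == x2) == (y1 != y2)) && ((x1 == x2) == (z1 == z2))).

(** Curried boolean functions, so that a statement about a fixed number of signs can
    be decided by evaluating it on all of them. *)
Fixpoint sign_fun n : Type := if n is m.+1 then bool -> sign_fun m else bool.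

Fixpoint all_signs n : sign_fun n -> bool :=
  if n is m.+1 then fun f => all_signs (f true) && all_signs (f false) else id.

Fixpoint valid_signs n : sign_fun n -> Prop :=
  match n return sign_fun n -> Prop with
  | 0 => is_true
  | m.+1 => fun f => forall b, valid_signs (f b)
  end.

Lemma all_signsP n (f : sign_fun n) : all_signs f -> valid_signs f.
Proof. by elim: n f => [|n IH] f //= /andP[? ?] []; apply: IH. Qed.

(** The sign [sijkl] stands for the orientation of the vectors [i], [j], [k], [l] among
    o, p, a, b, c, d in this order; the conclusion is that of [hit_tetrahedron]. *)
Definition tetrahedron_check : sign_fun 15 :=
  fun s0123 s0124 s0125 s0134 s0135 s0145 s0234 s0235 s0245
      s0345 s1234 s1235 s1245 s1345 s2345 =>
  plucker_signs s0123 s0145 s0124 s0135 s0125 s0134 ==>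
  plucker_signs s0123 s0245 s0124 s0235 s0125 s0234 ==>
  plucker_signs s0123 s0345 s0134 s0235 s0135 s0234 ==>
  plucker_signs s0124 s0345 s0134 s0245 s0145 s0234 ==>
  plucker_signs s0123 s1245 s0124 s1235 s0125 s1234 ==>
  plucker_signs s0123 s1345 s0134 s1235 s0135 s1234 ==>
  plucker_signs s0124 s1345 s0134 s1245 s0145 s1234 ==>
  plucker_signs s0123 s2345 s0234 s1235 s0235 s1234 ==>
  plucker_signs s0124 s2345 s0234 s1245 s0245 s1234 ==>
  plucker_signs s0134 s2345 s0234 s1345 s0345 s1234 ==>
  (common_sign s2345 (~~ s1345) s1245 s1235 (~~ s1234)
   - common_sign s2345 (~~ s0345) s0245 s0235 (~~ s0234)
   + common_sign s1345 (~~ s0345) s0145 s0135 (~~ s0134)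
   - common_sign s1245 (~~ s0245) s0145 s0125 (~~ s0124)
  == common_sign s0123 (~~ s1234) s0234 (~~ s0134) s0124
   - common_sign s0123 (~~ s1235) s0235 (~~ s0135) s0125).

Lemma tetrahedron_checkP : valid_signs tetrahedron_check.
Proof. by apply: all_signsP; vm_compute. Qed.

Section Hit.
Variable R : realFieldType.
Local Notation vec := (vec4 {poly R}).
Implicit Types (a b c d o p x y : vec) (s : seq vec).

Definition orient a b c d : bool := ipos (det4 a b c d).

(** The nonzero determinants are listed in the order of [s] only; the others differ from
    them by a sign. *)
Definition generic s := forall i j k l, (i < j < k)%N -> (k < l < size s)%N ->
  det4 (nth (0,0,0,0) s i) (nth (0,0,0,0) s j) (nth (0,0,0,0) s k) (nth (0,0,0,0) s l) != 0.

(** By Cramer's rule, the five minors of o, a, b, c, d are, with alternating signs, the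
    coefficients of their only linear relation.  They agree in sign when the triangle
    o a b meets the segment c d (as cones over the origin), and the common sign is that
    of the intersection. *)
Definition hit o a b c d : int :=
  common_sign (orient a b c d) (~~ orient o b c d) (orient o a c d)
        (orient o a b d) (~~ orient o a b c).

(** The same for the position of the point x in the tetrahedron o p a b, counted with
    the orientation of the tetrahedron. *)
Definition inside o p a b x : int :=
  common_sign (orient o p a b) (~~ orient p a b x) (orient o a b x)
        (~~ orient o p b x) (orient o p a x).

Lemma plucker_signsP (x1 x2 y1 y2 z1 z2 : {poly R}) :
  x1 != 0 -> x2 != 0 -> y1 != 0 -> y2 != 0 -> z1 != 0 -> z2 != 0 ->
  x1 * x2 - y1 * y2 + z1 * z2 = 0 ->
  plucker_signs (ipos x1) (ipos x2) (ipos y1) (ipos y2) (ipos z1) (ipos z2).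
Proof.
move=> x10 x20 y10 y20 z10 z20 E.
have y12 : y1 * y2 != 0 by exact: mulf_neq0.
have x12 : x1 * x2 != 0 by exact: mulf_neq0.
have z12 : z1 * z2 != 0 by exact: mulf_neq0.
have ipos0 : ipos (0 : {poly R}) = false by rewrite /ipos low_coef0 ltxx.
rewrite /plucker_signs -(iposM x10 x20) -(iposM y10 y20) -(iposM z10 z20) -iposN //.
apply/negP => /andP[/eqP e1 /eqP e2].
case h: (ipos (x1 * x2)) e1 e2 => /esym e1 /esym e2.
  by have := iposD (iposD h e1) e2; rewrite E ipos0.
have h0 : ipos (- (x1 * x2)) by rewrite iposN // h.
have h1 : ipos (- - (y1 * y2)) by rewrite iposN ?oppr_eq0 // e1.
have h2 : ipos (- (z1 * z2)) by rewrite iposN // e2.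
by have := iposD (iposD h0 h1) h2; rewrite -!opprD E oppr0 ipos0.
Qed.

(** The signed crossings of the segment c d with the faces of the tetrahedron o p a b add
    up to the change of the indicator of the tetrahedron along the segment.  All terms
    depend only on the signs of fifteen determinants, and the identity holds for all
    signs that the Pluecker relations allow. *)
Lemma hit_tetrahedron o p a b c d : generic [:: o; p; a; b; c; d] ->
  hit p a b c d - hit o a b c d + hit o p b c d - hit o p a c d
  = inside o p a b c - inside o p a b d.
Proof.
move=> G.
have G' i j k l (h1 : (i < j < k)%N) (h2 : (k < l < 6)%N) := G i j k l h1 h2.
have := tetrahedron_checkP (orient o p a b) (orient o p a c) (orient o p a d)
  (orient o p b c) (orient o p b d) (orient o p c d) (orient o a b c) (orient o a b d)
  (orient o a c d) (orient o b c d) (orient p a b c) (orient p a b d)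
  (orient p a c d) (orient p b c d) (orient a b c d).
rewrite /tetrahedron_check.
have g0123 := G' 0 1 2 3 isT isT; have g0124 := G' 0 1 2 4 isT isT.
have g0125 := G' 0 1 2 5 isT isT; have g0134 := G' 0 1 3 4 isT isT.
have g0135 := G' 0 1 3 5 isT isT; have g0145 := G' 0 1 4 5 isT isT.
have g0234 := G' 0 2 3 4 isT isT; have g0235 := G' 0 2 3 5 isT isT.
have g0245 := G' 0 2 4 5 isT isT; have g0345 := G' 0 3 4 5 isT isT.
have g1234 := G' 1 2 3 4 isT isT; have g1235 := G' 1 2 3 5 isT isT.
have g1245 := G' 1 2 4 5 isT isT; have g1345 := G' 1 3 4 5 isT isT.
have g2345 := G' 2 3 4 5 isT isT.
have [gp0 [gp1 [gp2 [gp3 [gp4 [gp5 [gp6 [gp7 [gp8 gp9]]]]]]]]] := grassmann_plucker o p a b c d.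
do 10 (move/implyP=> H; have {}H : _ := H ltac:(exact: plucker_signsP); move: H).
by move/eqP.
Qed.

End Hit.

Definition coord4 (A : Type) (x : A * A * A * A) (i : nat) : A :=
  let: (x1, x2, x3, x4) := x in
  match i with 0%N => x1 | 1%N => x2 | 2%N => x3 | _ => x4 end.

Lemma cramer (A : comNzRingType) (o a b c d : vec4 A) i :
  det4 a b c d * coord4 o i - det4 o b c d * coord4 a i + det4 o a c d * coord4 b i
  - det4 o a b d * coord4 c i + det4 o a b c * coord4 d i = 0.
Proof. by case: i => [|[|[|i]]]; rewrite /coord4; det4_ring. Qed.

Section Alternation.
Variable A : comNzRingType.
Implicit Types x y z w : vec4 A.

Lemma det4_swap12 x y z w : det4 y x z w = - det4 x y z w.
Proof. by det4_ring. Qed.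
Lemma det4_swap23 x y z w : det4 x z y w = - det4 x y z w.
Proof. by det4_ring. Qed.
Lemma det4_swap34 x y z w : det4 x y w z = - det4 x y z w.
Proof. by det4_ring. Qed.
Lemma det4_swap_pairs x y z w : det4 z w x y = det4 x y z w.
Proof. by det4_ring. Qed.
Lemma det4_rot x y z w : det4 x w y z = det4 x y z w.
Proof. by det4_ring. Qed.
Lemma det4_opp x y z w : det4 (opp4 x) y z w = - det4 x y z w.
Proof. by rewrite /opp4; det4_ring. Qed.

Lemma det4_moment a b c d :
  det4 (moment4 a) (moment4 b) (moment4 c) (moment4 d)
  = (b - a) * (c - a) * (d - a) * (c - b) * (d - b) * (d - c) :> A.
Proof. by rewrite /moment4 /det4; ring. Qed.

End Alternation.

(** In degree four only the determinant of the perturbations is left. *)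
Lemma det4_lin (A : comNzRingType) (t : A) (x x' y y' z z' w w' : vec4 A) :
  det4 (lin4 t x x') (lin4 t y y') (lin4 t z z') (lin4 t w w')
  = det4 x y z w
  + t * (det4 x' y z w + det4 x y' z w + det4 x y z' w + det4 x y z w')
  + t ^+ 2 * (det4 x' y' z w + det4 x' y z' w + det4 x' y z w'
              + det4 x y' z' w + det4 x y' z w' + det4 x y z' w')
  + t ^+ 3 * (det4 x' y' z' w + det4 x' y' z w' + det4 x' y z' w' + det4 x y' z' w')
  + t ^+ 4 * det4 x' y' z' w'.
Proof. by rewrite /lin4; det4_ring. Qed.

Section Perturbation.
Variable R : realFieldType.

Definition const4 (x : vec4 R) : vec4 {poly R} :=
  let: (x1, x2, x3, x4) := x in (x1%:P, x2%:P, x3%:P, x4%:P).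

(** A label is a vector with a parameter of the moment curve; it stands for the vector
    moved infinitesimally in the direction of that point of the curve. *)
Definition perturb (l : vec4 R * R) : vec4 {poly R} :=
  lin4 'X (const4 l.1) (moment4 l.2%:P).

Lemma det4_const x y z w :
  det4 (const4 x) (const4 y) (const4 z) (const4 w) = (det4 x y z w)%:P.
Proof.
move: x y z w => [[[? ?] ?] ?] [[[? ?] ?] ?] [[[? ?] ?] ?] [[[? ?] ?] ?].
by rewrite /det4 /= !(polyCM, polyCD, polyCN).
Qed.

Lemma moment_const k : moment4 k%:P = const4 (moment4 k).
Proof. by rewrite /moment4 /const4 !polyC_exp. Qed.

Lemma det4_perturb_coef0 a b c d :
  (det4 (perturb a) (perturb b) (perturb c) (perturb d))`_0 = det4 a.1 b.1 c.1 d.1.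
Proof.
rewrite /perturb det4_lin !moment_const !det4_const !coefD !coef0M !coefC coefX ?coefXn /=.
by rewrite !mul0r !addr0.
Qed.

(** The coefficient of degree four is a Vandermonde determinant. *)
Lemma det4_perturb_neq0 a b c d : uniq [:: a.2; b.2; c.2; d.2] ->
  det4 (perturb a) (perturb b) (perturb c) (perturb d) != 0.
Proof.
move=> U; set p := det4 _ _ _ _.
have E : p`_4 = det4 (moment4 a.2) (moment4 b.2) (moment4 c.2) (moment4 d.2).
  rewrite /p /perturb det4_lin !moment_const !det4_const -!polyCD.
  by rewrite -['X]expr1 !coefD !coefXnM !coefC /= !add0r.
have : p`_4 != 0.
  move: U; rewrite E det4_moment /= !inE !negb_or => /and4P[/and3P[? ? ?] /andP[? ?] ? _].
  by rewrite !mulf_neq0 // subr_eq0 eq_sym.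
by apply: contra_neq => ->; rewrite coef0.
Qed.

Lemma perturb_generic (s : seq (vec4 R * R)) :
  uniq [seq l.2 | l <- s] -> generic [seq perturb l | l <- s].
Proof.
move=> U i j k l /andP[ij jk] /andP[kl]; rewrite size_map => ls.
have ks := ltn_trans kl ls; have js := ltn_trans jk ks; have idx := ltn_trans ij js.
pose x0 : vec4 R * R := ((0, 0, 0, 0), 0).
rewrite !(nth_map x0) //; apply: det4_perturb_neq0.
have E m : (m < size s)%N -> (nth x0 s m).2 = nth 0 [seq l.2 | l <- s] m.
  by move=> ?; rewrite (nth_map x0).
rewrite /= !E // !inE !nth_uniq ?size_map // negb_or.
by rewrite !negb_or !ltn_eqF //; lia.
Qed.

End Perturbation.

Section HitSymmetry.
Variable R : realFieldType.
Implicit Types o p a b c d : vec4 {poly R}.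

Lemma generic_opp o s : generic (o :: s) -> generic (opp4 o :: s).
Proof.
move=> G i j k l h1 h2; have := G i j k l h1 h2.
have E m : (0 < m)%N -> nth (0, 0, 0, 0) (opp4 o :: s) m = nth (0, 0, 0, 0) (o :: s) m.
  by case: m.
rewrite (E j) ?(E k) ?(E l); [|lia..].
by case: (posnP i) => [->|/E->//]; rewrite /= det4_opp oppr_eq0.
Qed.

Section FiveVectors.
Variables o a b c d : vec4 {poly R}.
Hypothesis G : generic [:: o; a; b; c; d].

Let oabc : det4 o a b c != 0. Proof. exact: (G (i:=0) (j:=1) (k:=2) (l:=3)). Qed.
Let oabd : det4 o a b d != 0. Proof. exact: (G (i:=0) (j:=1) (k:=2) (l:=4)). Qed.
Let oacd : det4 o a c d != 0. Proof. exact: (G (i:=0) (j:=1) (k:=3) (l:=4)). Qed.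
Let obcd : det4 o b c d != 0. Proof. exact: (G (i:=0) (j:=2) (k:=3) (l:=4)). Qed.
Let abcd : det4 a b c d != 0. Proof. exact: (G (i:=1) (j:=2) (k:=3) (l:=4)). Qed.

Lemma hit_swapl : hit o b a c d = - hit o a b c d.
Proof.
rewrite /hit /orient (det4_swap12 a b) 2!(det4_swap23 _ a b) !iposN //.
by do !case: (ipos _).
Qed.

Lemma hit_swapr : hit o a b d c = - hit o a b c d.
Proof.
rewrite /hit /orient !(det4_swap34 _ _ c d) !iposN //.
by do !case: (ipos _).
Qed.

(** Both sides ask for a relation o + c + d = a + b with positive coefficients; on the
    left, o has been moved across. *)
Lemma hit_opp : hit (opp4 o) a b c d = hit o c d a b.
Proof.
rewrite /hit /orient !det4_opp !iposN // (det4_swap_pairs a b c d) (det4_rot o a b d).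
rewrite (det4_rot o a b c) -(det4_rot o c d b) -(det4_rot o c d a).
by do !case: (ipos _).
Qed.

(** The segments a b and c d cross when they are projected from o: no condition
    remains on the sign of the coefficient of o, that is on which one is in front. *)
Definition crosses : bool :=
  [&& orient o b c d != orient o a c d, orient o a c d == orient o a b d
    & orient o a b d != orient o a b c].

Lemma hit_eq0 : ~~ crosses -> hit o a b c d = 0 /\ hit (opp4 o) a b c d = 0.
Proof.
rewrite /crosses /hit /orient !det4_opp !iposN //.
by do !case: (ipos _).
Qed.

(** When the projections cross, exactly one of the segments is in front. *)
Lemma hit_crosses : odd `|hit o a b c d| (+) odd `|hit o c d a b| = crosses.
Proof.
rewrite -hit_opp /crosses /hit /orient !det4_opp !iposN //.
by do !case: (ipos _).
Qed.

End FiveVectors.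
End HitSymmetry.

Section LimitRelation.
Variable R : realFieldType.
Implicit Types o a b c d : vec4 {poly R}.

(** If the perturbed segments cross, so do the original ones, in the weak sense: dividing
    Cramer's relation by the largest possible power of ['X] and then setting ['X] to zero
    leaves a nontrivial relation whose coefficients have the same weak signs. *)
Lemma crosses_relation o a b c d : generic [:: o; a; b; c; d] -> crosses o a b c d ->
  exists r1 r2 r3 r4 r0 : R,
  [/\ [&& 0 <= r1, 0 <= r2, 0 <= r3 & 0 <= r4],
      ~~ [&& r1 == 0, r2 == 0, r3 == 0, r4 == 0 & r0 == 0] &
      forall i, r1 * (coord4 a i)`_0 + r2 * (coord4 b i)`_0
              = r3 * (coord4 c i)`_0 + r4 * (coord4 d i)`_0 + r0 * (coord4 o i)`_0].
Proof.
move=> G X.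
pose ms := [:: det4 a b c d; det4 o b c d; det4 o a c d; det4 o a b d; det4 o a b c].
have ex : exists k, has (fun m : {poly R} => m`_k != 0) ms.
  exists (size (det4 a b c d)).-1; apply/orP; left.
  by rewrite -lead_coefE lead_coef_eq0; apply: (G 1 2 3 4)%N.
(* The lowest degree in which one of the five minors has a nonzero coefficient. *)
case: (ex_minnP ex) => k mk min_k.
have lo m : m \in ms -> forall j, (j < k)%N -> m`_j = 0.
  move=> mm j jk; apply/eqP/negPn/negP => h.
  have /min_k : has (fun m : {poly R} => m`_j != 0) ms by apply/hasP; exists m.
  by rewrite leqNgt jk.
have l0 : forall j, (j < k)%N -> (det4 a b c d)`_j = 0 by apply: lo; rewrite !inE eqxx ?orbT.
have l1 : forall j, (j < k)%N -> (det4 o b c d)`_j = 0 by apply: lo; rewrite !inE eqxx ?orbT.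
have l2 : forall j, (j < k)%N -> (det4 o a c d)`_j = 0 by apply: lo; rewrite !inE eqxx ?orbT.
have l3 : forall j, (j < k)%N -> (det4 o a b d)`_j = 0 by apply: lo; rewrite !inE eqxx ?orbT.
have l4 : forall j, (j < k)%N -> (det4 o a b c)`_j = 0 by apply: lo; rewrite !inE eqxx ?orbT.
have rel i : (det4 a b c d)`_k * (coord4 o i)`_0 - (det4 o b c d)`_k * (coord4 a i)`_0
    + (det4 o a c d)`_k * (coord4 b i)`_0 - (det4 o a b d)`_k * (coord4 c i)`_0
    + (det4 o a b c)`_k * (coord4 d i)`_0 = 0.
  rewrite -[RHS](coef0 _ k) -(cramer o a b c d i) !(coefD, coefN).
  by rewrite !coefM_lowest.
move: X mk (ipos_coef_sign l1) (ipos_coef_sign l2) (ipos_coef_sign l3) (ipos_coef_sign l4) rel.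
rewrite /crosses /orient /=.
move: (_`_k) (_`_k) (_`_k) (_`_k) (_`_k) => m4 m3 m2 m1 m0.
case: (ipos _); case: (ipos _); case: (ipos _); case: (ipos _) => //= _.
  move=> nz s1 s2 s3 s4 rel; exists m1, (- m2), (- m3), m4, m0; split.
  - by rewrite !oppr_ge0; apply/and4P.
  - by rewrite !oppr_eq0; move: nz; do !case: eqP.
  - by move=> i; have := rel i; lra.
move=> nz s1 s2 s3 s4 rel; exists (- m1), m2, m3, (- m4), (- m0); split.
- by rewrite !oppr_ge0; apply/and4P.
- by rewrite !oppr_eq0; move: nz; do !case: eqP.
- by move=> i; have := rel i; lra.
Qed.

End LimitRelation.

(** * Linking of closed chains *)

Section Chains.
Variables (R : realFieldType) (T : eqType) (w : T -> vec4 {poly R}).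
Local Notation vec := (vec4 {poly R}).
Implicit Types (o p : vec) (P Q : seq (T * T)).

(** A chain without boundary, tested against all functions on the vertices. *)
Definition closed_chain P :=
  forall phi : T -> int, \sum_(e <- P) (phi e.2 - phi e.1) = 0.

Lemma closed_chainN P (cP : closed_chain P) (phi : T -> int) :
  \sum_(e <- P) (phi e.1 - phi e.2) = 0.
Proof.
have H := cP (fun x => - phi x); rewrite -[RHS]H; apply: eq_bigr => e _.
by rewrite opprK addrC.
Qed.

(** The algebraic number of intersections of the chain [Q] with the cone over [P] with
    apex [o].  If [o] is at infinity these are the crossings at which [Q] is in front. *)
Definition link o P Q : int :=
  \sum_(e <- P) \sum_(g <- Q) hit o (w e.1) (w e.2) (w g.1) (w g.2).

Definition generic_chains (s : seq vec) P Q :=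
  forall e g, e \in P -> g \in Q ->
  generic (s ++ [:: w e.1; w e.2; w g.1; w g.2]).

(** The cones over [P] from the two apices differ by the boundaries of the tetrahedra
    [o p a b], and by the triangles [o p a], which cancel around [P].  A boundary meets the
    closed chain [Q] algebraically zero times. *)
Lemma link_apex o p P Q : closed_chain P -> closed_chain Q ->
  generic_chains [:: o; p] P Q -> link o P Q = link p P Q.
Proof.
move=> cP cQ G; apply/esym/eqP; rewrite -subr_eq0 -sumrB.
rewrite (eq_big_seq (fun e => \sum_(g <- Q)
   ((inside o p (w e.1) (w e.2) (w g.1) - inside o p (w e.1) (w e.2) (w g.2))
    + (hit o p (w e.1) (w g.1) (w g.2) - hit o p (w e.2) (w g.1) (w g.2))))).
  under eq_bigr => e _.
    rewrite big_split /= (closed_chainN cQ (fun x => inside o p (w e.1) (w e.2) (w x))).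
    rewrite add0r; over.
  rewrite exchange_big /= big1 // => g _.
  exact: (closed_chainN cP (fun x => hit o p (w x) (w g.1) (w g.2))).
move=> e eP; rewrite -sumrB; apply: eq_big_seq => g gQ /=.
have <- := hit_tetrahedron (G e g eP gQ).
lia.
Qed.

Lemma link_opp o P Q : generic_chains [:: o] P Q -> link (opp4 o) P Q = link o Q P.
Proof.
move=> G; rewrite /link [RHS]exchange_big /=.
by apply: eq_big_seq => e eP; apply: eq_big_seq => g gQ; apply: hit_opp; exact: G.
Qed.

(** Seen from the opposite side, the chain in front is the other one; and the count does
    not depend on the side. *)
Lemma link_sym o p P Q : closed_chain P -> closed_chain Q ->
  generic_chains [:: o; p] P Q -> generic_chains [:: o] P Q -> link o P Q = link o Q P.
Proof.
move=> cP cQ G2 G1; rewrite -(link_opp G1) (link_apex cP cQ G2).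
rewrite [RHS](@link_apex _ p) // => e g eP gQ.
by apply: generic_opp; apply: G2.
Qed.

Lemma link1 o a b c d : link o [:: (a, b)] [:: (c, d)] = hit o (w a) (w b) (w c) (w d).
Proof. by rewrite /link !big_seq1. Qed.

Lemma link_flipr o P a b :
  (forall e, e \in P -> generic [:: o; w e.1; w e.2; w a; w b]) ->
  link o P [:: (b, a)] = - link o P [:: (a, b)].
Proof.
move=> G; rewrite /link -sumrN; apply: eq_big_seq => e eP.
by rewrite !big_seq1 /= hit_swapr //; exact: G.
Qed.

Lemma link_flipl o P a b :
  (forall e, e \in P -> generic [:: o; w a; w b; w e.1; w e.2]) ->
  link o [:: (b, a)] P = - link o [:: (a, b)] P.
Proof.
move=> G; rewrite /link !big_seq1 -sumrN; apply: eq_big_seq => e eP /=.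
by rewrite hit_swapl //; exact: G.
Qed.

End Chains.

(** * From diagrams to orientations *)

Section Coordinates.
Variable R : realType.
Local Notation R3 := 'rV[R]_3.
Implicit Types (a b c d u v w x : R3).

Definition cx x : R := x 0 (@Ordinal 3 0 isT).
Definition cy x : R := x 0 (@Ordinal 3 1 isT).
Definition cz x : R := x 0 (@Ordinal 3 2 isT).

Lemma cxE x (j : 'I_3) : j = 0%N :> nat -> x 0 j = cx x.
Proof. by move=> e; congr (x 0 _); apply: val_inj. Qed.
Lemma cyE x (j : 'I_3) : j = 1%N :> nat -> x 0 j = cy x.
Proof. by move=> e; congr (x 0 _); apply: val_inj. Qed.
Lemma czE x (j : 'I_3) : j = 2%N :> nat -> x 0 j = cz x.
Proof. by move=> e; congr (x 0 _); apply: val_inj. Qed.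

Lemma row3P x y : cx x = cx y -> cy x = cy y -> cz x = cz y -> x = y.
Proof.
move=> h0 h1 h2; apply/rowP => -[[|[|[|//]]] i].
- by rewrite !cxE.
- by rewrite !cyE.
- by rewrite !czE.
Qed.

Lemma det3E u v w : det3 u v w =
  cx u * (cy v * cz w - cz v * cy w) - cy u * (cx v * cz w - cz v * cx w)
  + cz u * (cx v * cy w - cy v * cx w).
Proof.
rewrite /det3 (expand_det_row _ ord0) !big_ord_recl big_ord0 /cofactor.
rewrite !(expand_det_row _ ord0) !big_ord_recl !big_ord0 /cofactor !det_mx11 !mxE /=.
repeat match goal with |- context[fun_of_matrix ?x 0 ?j] =>
  first [rewrite (@cxE x j erefl) | rewrite (@cyE x j erefl) | rewrite (@czE x j erefl)] end.
rewrite !(expr0, expr1, expr2) /= ; ring.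
Qed.

Lemma cxD x y : cx (x + y) = cx x + cx y. Proof. by rewrite /cx mxE. Qed.
Lemma cyD x y : cy (x + y) = cy x + cy y. Proof. by rewrite /cy mxE. Qed.
Lemma czD x y : cz (x + y) = cz x + cz y. Proof. by rewrite /cz mxE. Qed.
Lemma cxN x : cx (- x) = - cx x. Proof. by rewrite /cx mxE. Qed.
Lemma cyN x : cy (- x) = - cy x. Proof. by rewrite /cy mxE. Qed.
Lemma czN x : cz (- x) = - cz x. Proof. by rewrite /cz mxE. Qed.
Lemma cxZ k x : cx (k *: x) = k * cx x. Proof. by rewrite /cx mxE. Qed.
Lemma cyZ k x : cy (k *: x) = k * cy x. Proof. by rewrite /cy mxE. Qed.
Lemma czZ k x : cz (k *: x) = k * cz x. Proof. by rewrite /cz mxE. Qed.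
Definition coordE := (cxD, cyD, czD, cxN, cyN, czN, cxZ, cyZ, czZ).

(** Homogeneous coordinates; directions are the points at infinity, so that projecting
    along a direction is projecting from a point. *)
Definition point4 x : vec4 R := (cx x, cy x, cz x, 1).
Definition direction4 x : vec4 R := (cx x, cy x, cz x, 0).

End Coordinates.

Lemma addend_exists (V : zmodType) (x y : V) : exists z, y = x + z.
Proof. by exists (y - x); rewrite addrC subrK. Qed.

(** The equation X - Y = h u for points X of a b and Y of c d is the linear relation of the
    five homogeneous vectors; the minors are its coefficients times [K], up to sign. *)
Lemma crossing_minors (R : realType) (a b c d u : 'rV[R]_3) (s t h : R) :
  cx a = cx c + t * (cx d - cx c) - s * (cx b - cx a) + h * cx u ->
  cy a = cy c + t * (cy d - cy c) - s * (cy b - cy a) + h * cy u ->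
  cz a = cz c + t * (cz d - cz c) - s * (cz b - cz a) + h * cz u ->
  let K := det3 (b - a) (d - c) u in
  [/\ det4 (point4 a) (point4 b) (point4 c) (point4 d) = - (h * K),
      det4 (direction4 u) (point4 b) (point4 c) (point4 d) = - ((1 - s) * K),
      det4 (direction4 u) (point4 a) (point4 c) (point4 d) = s * K,
      det4 (direction4 u) (point4 a) (point4 b) (point4 d) = (1 - t) * K &
      det4 (direction4 u) (point4 a) (point4 b) (point4 c) = - (t * K) /\
      det3 (b - a) (d - c) (a - c) = h * K].
Proof.
rewrite /det4 /= !det3E !coordE.
move: (cx a) (cx b) (cx c) (cx d) (cx u) => xa xb xc xd xu.
move: (cy a) (cy b) (cy c) (cy d) (cy u) => ya yb yc yd yu.
move: (cz a) (cz b) (cz c) (cz d) (cz u) => za zb zc zd zu.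
(* Write b = a + e and d = c + f, so that the hypotheses become definitions of the
   coordinates of a. *)
have [xe ->] := addend_exists xa xb; have [xf ->] := addend_exists xc xd.
have [ye ->] := addend_exists ya yb; have [yf ->] := addend_exists yc yd.
have [ze ->] := addend_exists za zb; have [zf ->] := addend_exists zc zd.
have sub (x e : R) : x + e - x = e by rewrite addrAC subrr add0r.
rewrite !sub => -> -> ->.
by split; [ring|ring|ring|ring|split; ring].
Qed.

Section LocalCrossing.
Variable R : realType.
Variables (a b c d u : 'rV[R]_3) (ka kb kc kd ku : R).
Hypothesis uk : uniq [:: ku; ka; kb; kc; kd].
Let U := perturb (direction4 u, ku).
Let A := perturb (point4 a, ka).
Let B := perturb (point4 b, kb).
Let C := perturb (point4 c, kc).
Let D := perturb (point4 d, kd).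

Let G : generic [:: U; A; B; C; D].
Proof.
exact: (@perturb_generic _ [:: (direction4 u, ku); (point4 a, ka); (point4 b, kb);
                               (point4 c, kc); (point4 d, kd)]).
Qed.

Let coef0E l i : (coord4 (perturb l) i)`_0 = coord4 l.1 i :> R.
Proof.
case: l => -[[[x y] z] t] k; rewrite /perturb /coord4 /=.
by case: i => [|[|[|i]]]; rewrite coefD coefXM coefC addr0.
Qed.

(** A pair of sides whose projections are disjoint stays so after the perturbation. *)
Lemma crosses_crossing : u != 0 -> crosses U A B C D -> crossing u (a, b) (c, d).
Proof.
move=> un0 /(crosses_relation G)[r1 [r2 [r3 [r4 [r0 [/and4P[r1g r2g r3g r4g] nz rel]]]]]].
have := (rel 0, rel 1, rel 2, rel 3)%N; rewrite !coef0E /= !(mulr1, mulr0, addr0).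
move=> [[[ex ey] ez] et].
have r12 : 0 < r1 + r2.
  rewrite lt_def addr_ge0 // andbT; apply/eqP => r12.
  have [z1 z2 z3 z4] : [/\ r1 = 0, r2 = 0, r3 = 0 & r4 = 0] by split; lra.
  move: nz; rewrite z1 z2 z3 z4 !eqxx /= => r00.
  have : r0 *: u == 0.
    apply/eqP; apply: row3P; rewrite !coordE; move: ex ey ez.
    - by rewrite z1 z2 z3 z4 /cx !mxE; lra.
    - by rewrite z1 z2 z3 z4 /cy !mxE; lra.
    - by rewrite z1 z2 z3 z4 /cz !mxE; lra.
  by rewrite scaler_eq0 (negbTE un0) orbF (negbTE r00).
have hne : r1 + r2 != 0 by rewrite gt_eqF.
exists (r2 / (r1 + r2)), (r4 / (r1 + r2)), (r0 / (r1 + r2)); split.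
- by rewrite divr_ge0 ?(ltW r12) //= ler_pdivrMr // mul1r; lra.
- by rewrite divr_ge0 ?(ltW r12) //= ler_pdivrMr // mul1r; lra.
have E x1 x2 x3 x4 x5 : r1 * x1 + r2 * x2 = r3 * x3 + r4 * x4 + r0 * x5 ->
  (1 - r2 / (r1 + r2)) * x1 + r2 / (r1 + r2) * x2
   - ((1 - r4 / (r1 + r2)) * x3 + r4 / (r1 + r2) * x4) = r0 / (r1 + r2) * x5.
  move=> e; have := mulfV hne; set v := _^-1 => vE.
  have -> : 1 - r2 * v = r1 * v by lra.
  have -> : 1 - r4 * v = r3 * v by rewrite -vE et; lra.
  by have := congr1 (fun z => z * v) e; lra.
by apply: row3P; rewrite /seg !coordE; apply: E.
Qed.

(** The minors are nonzero before the perturbation, which therefore preserves their signs.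
    Of the apices [U] and [opp4 U], one sees the second side in front and contributes the
    sign of the crossing, up to the global minus sign; the other contributes nothing. *)
Lemma crossing_hits (s t h : R) : 0 < s < 1 -> 0 < t < 1 -> h != 0 ->
  seg a b s - seg c d t = h *: u -> det3 (b - a) (d - c) u != 0 ->
  (hit U A B C D + hit (opp4 U) A B C D)%:~R = - crossing_sign (a, b) (c, d) :> R.
Proof.
move=> /andP[s0 s1] /andP[t0 t1] h0 E K0.
set K := det3 _ _ _ in K0.
have coord (f : 'rV[R]_3 -> R) : (forall x y, f (x + y) = f x + f y) ->
    (forall x, f (- x) = - f x) -> (forall k x, f (k *: x) = k * f x) ->
    f a = f c + t * (f d - f c) - s * (f b - f a) + h * f u.
  move=> fD fN fZ; have := congr1 f E; rewrite /seg !(fD, fN, fZ); lra.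
have ex := coord _ (@cxD R) (@cxN R) (@cxZ R); have ey := coord _ (@cyD R) (@cyN R) (@cyZ R).
have ez := coord _ (@czD R) (@czN R) (@czZ R).
have [e0 e1 e2 e3 [e4 e5]] := crossing_minors ex ey ez.
have f0 : (det4 A B C D)`_0 = - (h * K) by rewrite det4_perturb_coef0.
have f1 : (det4 U B C D)`_0 = - ((1 - s) * K) by rewrite det4_perturb_coef0.
have f2 : (det4 U A C D)`_0 = s * K by rewrite det4_perturb_coef0.
have f3 : (det4 U A B D)`_0 = (1 - t) * K by rewrite det4_perturb_coef0.
have f4 : (det4 U A B C)`_0 = - (t * K) by rewrite det4_perturb_coef0.
have -> : crossing_sign (a, b) (c, d) = Num.sg (h * K) by rewrite /crossing_sign /= e5.
have pos_mul (x : R) : x != 0 -> (0 < x * K) = ((0 < x) == (0 < K)).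
  move=> x0; have [Kp|Kn|/esym KE] := ltgtP 0 K; last by rewrite KE eqxx in K0.
  - by rewrite pmulr_lgt0 // eqb_id.
  - by rewrite nmulr_lgt0 // eqbF_neg -leNgt le_eqVlt (negbTE x0).
have posE (p : {poly R}) x : p`_0 = x -> x != 0 -> ipos p = (0 < x).
  by move=> <- p0; rewrite /ipos low_coef_coef0.
have posN (x : R) : x != 0 -> (0 < - x) = ~~ (0 < x).
  by move=> x0; rewrite oppr_gt0 -leNgt le_eqVlt (negbTE x0).
have s0' : s != 0 by rewrite gt_eqF.
have t0' : t != 0 by rewrite gt_eqF.
have s1' : 0 < 1 - s by lra.
have t1' : 0 < 1 - t by lra.
have s1n := lt0r_neq0 s1'; have t1n := lt0r_neq0 t1'.
have nz (p : {poly R}) x : p`_0 = x -> x != 0 -> p != 0.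
  by move=> <-; apply: contra_neq => ->; rewrite coef0.
have p0 : orient A B C D = ~~ ((0 < h) == (0 < K)).
  by rewrite /orient (posE _ _ f0) ?oppr_eq0 ?mulf_neq0 // posN ?mulf_neq0 // pos_mul.
have p1 : orient U B C D = ~~ (0 < K).
  rewrite /orient (posE _ _ f1) ?oppr_eq0 ?mulf_neq0 // posN ?mulf_neq0 // pos_mul //.
  by rewrite s1'.
have p2 : orient U A C D = (0 < K).
  by rewrite /orient (posE _ _ f2) ?mulf_neq0 // pos_mul // s0.
have p3 : orient U A B D = (0 < K).
  by rewrite /orient (posE _ _ f3) ?mulf_neq0 // pos_mul // t1'.
have p4 : orient U A B C = ~~ (0 < K).
  rewrite /orient (posE _ _ f4) ?oppr_eq0 ?mulf_neq0 // posN ?mulf_neq0 // pos_mul //.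
  by rewrite t0.
have oppE X Y Z : det4 U X Y Z != 0 -> orient (opp4 U) X Y Z = ~~ orient U X Y Z.
  by move=> n0; rewrite /orient det4_opp iposN.
have n1 : det4 U B C D != 0 by apply: nz f1 _; rewrite oppr_eq0 mulf_neq0.
have n2 : det4 U A C D != 0 by apply: nz f2 _; rewrite mulf_neq0.
have n3 : det4 U A B D != 0 by apply: nz f3 _; rewrite mulf_neq0.
have n4 : det4 U A B C != 0 by apply: nz f4 _; rewrite oppr_eq0 mulf_neq0.
rewrite /hit !oppE // p0 p1 p2 p3 p4.
have -> : Num.sg (h * K) = if (0 < h) == (0 < K) then 1 else -1.
  rewrite -pos_mul //; have := mulf_neq0 h0 K0.
  by case: sgrP => // _ _; rewrite ltxx.
case: (0 < h); case: (0 < K); rewrite /common_sign /=;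
  by rewrite ?addr0 ?add0r ?opprK ?mulrNz.
Qed.

End LocalCrossing.

(** * Regular directions *)

Section RegularDirections.
Variable R : realType.
Local Notation R3 := 'rV[R]_3.
Implicit Types (a b c d u v w x : R3) (S : seq R3).

Lemma nonroot_exists (p : {poly R}) : p != 0 -> exists k, p.[k] != 0.
Proof.
move=> p0; pose rs : seq R := [seq i%:R | i <- iota 0 (size p)].
have [ar|] := boolP (all (root p) rs); last by move/allPn => [k _ h]; exists k.
have /(max_poly_roots p0 ar) : uniq rs.
  by rewrite map_inj_uniq ?iota_uniq //; exact: (mulrIn (oner_neq0 R)).
by rewrite size_map size_iota ltnn.
Qed.

Definition row3 (x y z : R) : R3 := \row_j [:: x; y; z]`_j.

Lemma cx_row3 (x y z : R) : cx (row3 x y z) = x. Proof. by rewrite /cx mxE. Qed.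
Lemma cy_row3 (x y z : R) : cy (row3 x y z) = y. Proof. by rewrite /cy mxE. Qed.
Lemma cz_row3 (x y z : R) : cz (row3 x y z) = z. Proof. by rewrite /cz mxE. Qed.
Definition row3E := (cx_row3, cy_row3, cz_row3).

(** The direction [u] is in the plane of two vectors of [D] only if they are parallel. *)
Definition general_wrt (D : seq R3) u :=
  forall v w, v \in D -> w \in D -> det3 v w u = 0 -> forall x, det3 v w x = 0.

(** A plane through the origin contains at most two of the directions (1, k, k^2), so that
    all but finitely many of them avoid the planes spanned by two vectors of [D]. *)
Lemma general_exists (D : seq R3) : exists2 u, u != 0 & general_wrt D u.
Proof.
pose poly2 (n : R * R * R) : {poly R} := n.1.1%:P + n.1.2%:P * 'X + n.2%:P * 'X^2.
pose nrm (vw : R3 * R3) := (cy vw.1 * cz vw.2 - cz vw.1 * cy vw.2,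
  cz vw.1 * cx vw.2 - cx vw.1 * cz vw.2, cx vw.1 * cy vw.2 - cy vw.1 * cx vw.2).
pose N := [seq poly2 (nrm (v, w)) | v <- D, w <- D].
have [k hk] : exists k, (\prod_(p <- N | p != 0) p).[k] != 0.
  by apply: nonroot_exists; rewrite prodf_seq_neq0; apply/allP => p _; apply/implyP.
exists (row3 1 k (k ^+ 2)).
  by apply/eqP => /(congr1 (@cx R)); rewrite row3E /cx mxE => /eqP; rewrite oner_eq0.
move=> v w vD wD; rewrite !det3E !row3E => h x.
have pN : poly2 (nrm (v, w)) \in N by apply/allpairsP; exists (v, w).
have p0 : poly2 (nrm (v, w)) = 0.
  apply: contraNeq hk => pn0; rewrite horner_prod prodf_seq_eq0; apply/hasP.
  exists (poly2 (nrm (v, w))) => //; rewrite pn0 /= !hornerE /nrm /=; apply/eqP.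
  by rewrite -[RHS]h; ring.
have := congr1 (fun p : {poly R} => (p`_0, p`_1, p`_2)) p0.
rewrite /poly2 /= !coefD !coefCM !coefX !coefXn !coefC /= !(mulr0, mulr1, addr0, add0r).
case=> n0 n1 n2; rewrite det3E.
transitivity (cx x * (cy v * cz w - cz v * cy w) + cy x * (cz v * cx w - cx v * cz w)
  + cz x * (cx v * cy w - cy v * cx w)); first by ring.
by rewrite n0 n1 n2 !mulr0 !addr0.
Qed.

Definition axes : seq R3 := [:: row3 1 0 0; row3 0 1 0; row3 0 0 1].

Lemma det3Zr h u v w : det3 u v (h *: w) = h * det3 u v w.
Proof. by rewrite !det3E !coordE; ring. Qed.

Lemma det3_axes v : (forall e, e \in axes -> forall x, det3 v e x = 0) -> v = 0.
Proof.
move=> H.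
have e1 : row3 1 0 0 \in axes by rewrite !inE eqxx.
have e2 : row3 0 1 0 \in axes by rewrite !inE eqxx ?orbT.
have e3 : row3 0 0 1 \in axes by rewrite !inE eqxx ?orbT.
have := (H _ e1 (row3 0 1 0), H _ e2 (row3 0 0 1), H _ e3 (row3 1 0 0)).
rewrite !det3E !row3E => -[[h1 h2] h3].
by apply: row3P; [rewrite [RHS]mxE|rewrite [RHS]mxE|rewrite [RHS]mxE]; lra.
Qed.

(** As [u] is in the span of [v] and [w], these are parallel; then [u] is itself a multiple
    of [w], hence in the plane of [w] and each axis, so [w] is parallel to all the axes. *)
Lemma general_not_in_plane D u v w (h r1 r2 : R) : general_wrt D u ->
  {subset axes <= D} -> v \in D -> w \in D -> w != 0 -> h != 0 ->
  h *: u = r1 *: v + r2 *: w -> False.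
Proof.
move=> gen aD vD wD w0 h0 E.
have zero x y : det3 x y (h *: u) = 0 -> det3 x y u = 0.
  by rewrite det3Zr => /eqP; rewrite mulf_eq0 (negbTE h0) => /eqP.
have vw0 x : det3 v w x = 0.
  by apply: gen => //; apply: zero; rewrite E !det3E !coordE; ring.
case/eqP: w0; apply: det3_axes => e eD; apply: gen => //; first exact: aD.
apply: zero; rewrite E; transitivity (r1 * det3 v w e); last by rewrite vw0 mulr0.
by rewrite !det3E !coordE; ring.
Qed.

Definition differences S : seq R3 := [seq x - y | x <- S, y <- S].

Definition sides_disjoint (P Q : seq R3) := forall a b c d (s t : R),
  (a, b) \in sides P -> (c, d) \in sides Q -> 0 <= s <= 1 -> 0 <= t <= 1 ->
  seg a b s != seg c d t.

Definition sides_proper (P : seq R3) := forall a b, (a, b) \in sides P -> a != b.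

Lemma sides_mem (P : seq R3) a b : (a, b) \in sides P -> a \in P /\ b \in P.
Proof.
move=> h; have := map_f fst h; have := map_f snd h; rewrite /sides.
by rewrite -/(unzip1 _) -/(unzip2 _) unzip1_zip ?unzip2_zip ?size_rot // mem_rot.
Qed.

(** A direction that is outside the planes spanned by the differences of vertices sees no
    crossing at a vertex, and no crossing of parallel sides: those would put it into the
    plane of two such differences. *)
Lemma regular_direction_exists (P Q : seq R3) :
  sides_disjoint P Q -> sides_proper P -> sides_proper Q ->
  exists u, regular_direction P Q u.
Proof.
move=> dPQ pP pQ; pose S := P ++ Q.
have [u u0 gen] := general_exists (axes ++ differences S).
have diffD x y : x \in S -> y \in S -> x - y \in axes ++ differences S.
  by move=> xS yS; rewrite mem_cat; apply/orP; right; apply/allpairsP; exists (x, y).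
have axD : {subset axes <= axes ++ differences S} by move=> e; rewrite mem_cat => ->.
exists u; split=> // a b c d s t h abP cdQ hs ht E.
have [aS bS] : a \in S /\ b \in S.
  by have [? ?] := sides_mem abP; rewrite !mem_cat; split; apply/orP; left.
have [cS dS] : c \in S /\ d \in S.
  by have [? ?] := sides_mem cdQ; rewrite !mem_cat; split; apply/orP; right.
have ab0 : b - a != 0 by rewrite subr_eq0 eq_sym; exact: pP.
have cd0 : d - c != 0 by rewrite subr_eq0 eq_sym; exact: pQ.
have h0 : h != 0.
  apply/eqP => h0; move: E; rewrite h0 scale0r => /eqP; rewrite subr_eq0; apply/negP.
  exact: dPQ.
(* A crossing at an end of a side exhibits [h *: u] as a combination of two
   differences of vertices. *)
have NP v w r1 r2 := @general_not_in_plane _ u v w h r1 r2 gen axD.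
move: E; rewrite /seg => E.
have s0 : s != 0.
  apply/eqP => s0; apply: (NP (a - c) (d - c) 1 (- t)); rewrite ?diffD // -E s0.
  by apply: row3P; rewrite !coordE; ring.
have s1 : s != 1.
  apply/eqP => s1; apply: (NP (b - c) (d - c) 1 (- t)); rewrite ?diffD // -E s1.
  by apply: row3P; rewrite !coordE; ring.
have t0 : t != 0.
  apply/eqP => t0; apply: (NP (a - c) (b - a) 1 s); rewrite ?diffD // -E t0.
  by apply: row3P; rewrite !coordE; ring.
have t1 : t != 1.
  apply/eqP => t1; apply: (NP (a - d) (b - a) 1 s); rewrite ?diffD // -E t1.
  by apply: row3P; rewrite !coordE; ring.
split; [by rewrite !lt_def; move: hs; rewrite s0 eq_sym s1
       |by rewrite !lt_def; move: ht; rewrite t0 eq_sym t1|].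
apply/eqP => K0.
(* If the two sides are parallel, the difference a - c is parallel to them too, and
   then so is [u]. *)
have par x : det3 (b - a) (d - c) x = 0 by apply: gen => //; apply: diffD.
have E' : h *: u = (a - c) + s *: (b - a) - t *: (d - c).
  by rewrite -E; apply: row3P; rewrite !coordE; ring.
have zero x y : det3 x y (h *: u) = 0 -> det3 x y u = 0.
  by rewrite det3Zr => /eqP; rewrite mulf_eq0 (negbTE h0) => /eqP.
have par' x : det3 (a - c) (b - a) x = 0.
  apply: gen; rewrite ?diffD //; apply: zero; rewrite E'.
  transitivity (- t * det3 (b - a) (d - c) (a - c)); last by rewrite par mulr0.
  by rewrite !det3E !coordE; ring.
case/eqP: ab0; apply: det3_axes => e eD; apply: gen; [exact: diffD|exact: axD|].
apply: zero; rewrite E'.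
transitivity (det3 (a - c) (b - a) e + t * det3 (b - a) (d - c) e).
  by rewrite !det3E !coordE; ring.
by rewrite par par' mulr0 addr0.
Qed.

End RegularDirections.

Lemma big_zip_fst (T U : Type) (V : nmodType) (s : seq T) (t : seq U) (F : T -> V) :
  size s = size t -> \sum_(e <- zip s t) F e.1 = \sum_(x <- s) F x.
Proof.
by move=> st; rewrite -[in RHS](@unzip1_zip _ _ s t) ?st // /unzip1 big_map.
Qed.

Lemma big_zip_snd (T U : Type) (V : nmodType) (s : seq T) (t : seq U) (F : U -> V) :
  size s = size t -> \sum_(e <- zip s t) F e.2 = \sum_(x <- t) F x.
Proof.
by move=> st; rewrite -[in RHS](@unzip2_zip _ _ s t) ?st // /unzip2 big_map.
Qed.

(** * The linking number as a bilinear count *)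

Section LinkingNumber.
Variable R : realType.
Local Notation R3 := 'rV[R]_3.
Variable S : seq R3.

(** The parameters 0 and 1 of the moment curve are kept for [apex] and for a direction
    of projection. *)
Definition generic_point (x : R3) : vec4 {poly R} := perturb (point4 x, (index x S).+2%:R).
(** A common apex for all pairs of polygons: its position is irrelevant by [link_apex], so
    an infinitesimal vector will do. *)
Definition apex : vec4 {poly R} := perturb ((0, 0, 0, 0), 0).

(** A linking number of chains that involves no direction of projection, and is bilinear
    by construction. *)
Definition chain_link (P Q : seq (R3 * R3)) : int := link generic_point apex P Q.

Lemma sides_closed (P : seq R3) : closed_chain (sides P).
Proof.
move=> phi; rewrite sumrB big_zip_snd ?size_rot // big_zip_fst ?size_rot //.
by apply/eqP; rewrite subr_eq0; apply/eqP/perm_big; rewrite perm_rot.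
Qed.

Definition separated (a b c d : R3) :=
  uniq [:: a; b; c; d] && all (fun x => x \in S) [:: a; b; c; d].

Lemma index_inj_nat (x y : R3) : x \in S -> y \in S -> x != y ->
  (index x S).+2%:R != (index y S).+2%:R :> R.
Proof.
move=> xS yS; rewrite eqr_nat !eqSS; apply: contra_neq => e.
by rewrite -(nth_index x xS) e nth_index.
Qed.

Lemma separated_labels a b c d : separated a b c d ->
  uniq [:: (index a S).+2%:R; (index b S).+2%:R; (index c S).+2%:R; (index d S).+2%:R : R].
Proof.
rewrite /separated /= !inE !andbT !negb_or.
move=> /andP[/and3P[/and3P[? ? ?] /andP[? ?] ?] /and4P[? ? ? ?]].
by rewrite !index_inj_nat.
Qed.

Lemma separated_all_labels a b c d : separated a b c d ->
  uniq [:: 0; 1; (index a S).+2%:R; (index b S).+2%:R; (index c S).+2%:R;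
           (index d S).+2%:R : R].
Proof.
move=> /separated_labels U; rewrite cons_uniq [X in _ && X]cons_uniq U andbT !inE !negb_or.
have n0 (k : nat) : 0 != k.+2%:R :> R by rewrite eq_sym pnatr_eq0.
have n1 (k : nat) : 1 != k.+2%:R :> R by rewrite (eqr_nat R 1).
by rewrite !n0 !n1 eq_sym oner_eq0.
Qed.

Lemma generic_separated v a b c d : separated a b c d ->
  generic [:: apex; perturb (v, 1);
    generic_point a; generic_point b; generic_point c; generic_point d].
Proof.
move=> /separated_all_labels U.
exact: (@perturb_generic _ [:: ((0, 0, 0, 0), 0); (v, 1); (point4 a, _); (point4 b, _);
  (point4 c, _); (point4 d, _)]).
Qed.

Lemma generic_separated_swap v a b c d : separated a b c d ->
  generic [:: perturb (v, 1); apex;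
    generic_point a; generic_point b; generic_point c; generic_point d].
Proof.
move=> /separated_all_labels U.
apply: (@perturb_generic _ [:: (v, 1); ((0, 0, 0, 0), 0); (point4 a, _); (point4 b, _);
  (point4 c, _); (point4 d, _)]).
by move: U; rewrite (uniq_catCA [:: 0] [:: 1] [:: _; _; _; _]).
Qed.

Lemma generic_drop_second (x y : vec4 {poly R}) s : generic (x :: y :: s) -> generic (x :: s).
Proof.
move=> G i j k l ij kl; pose g m := if m is m'.+1 then m'.+2 else 0%N.
have E m : nth (0, 0, 0, 0) (x :: s) m = nth (0, 0, 0, 0) (x :: y :: s) (g m) by case: m.
by rewrite !E; apply: G; rewrite /g /=; case: i j k l ij kl => [|i] [|j] [|k] [|l] //=; lia.
Qed.

Definition separated_chains (P Q : seq (R3 * R3)) :=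
  forall e g, e \in P -> g \in Q -> separated e.1 e.2 g.1 g.2.

(** The diagram formula adds the crossings with [Q] in front, which the apex [u] counts, to
    those with [P] in front, which [- u] counts; both sums equal that of the common apex.
    The factor one half compensates, and the minus sign comes from the order of the
    arguments of the determinants. *)
Lemma diagram_chain_link (P Q : seq R3) u : regular_direction P Q u -> sides_disjoint P Q ->
  separated_chains (sides P) (sides Q) ->
  diagram_lk u P Q = - (chain_link (sides P) (sides Q))%:~R.
Proof.
move=> [u0 reg] dPQ sep.
pose U : vec4 {poly R} := perturb (direction4 u, 1).
have G : generic_chains generic_point [:: apex; U] (sides P) (sides Q).
  by move=> e g eP gQ; apply: generic_separated; apply: sep.
have GU : generic_chains generic_point [:: U; apex] (sides P) (sides Q).
  by move=> e g eP gQ; apply: generic_separated_swap; apply: sep.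
have E1 : link generic_point U (sides P) (sides Q) = chain_link (sides P) (sides Q).
  by apply/esym/link_apex => //; exact: sides_closed.
have E2 : link generic_point (opp4 U) (sides P) (sides Q) = chain_link (sides P) (sides Q).
  apply/link_apex; [exact: sides_closed..|].
  by move=> e g eP gQ; apply: generic_opp; apply: GU.
rewrite /diagram_lk.
have E e g : e \in sides P -> g \in sides Q ->
   (if `[< crossing u e g >] then crossing_sign e g else 0)
   = - (hit U (generic_point e.1) (generic_point e.2) (generic_point g.1) (generic_point g.2)
      + hit (opp4 U) (generic_point e.1) (generic_point e.2) (generic_point g.1)
            (generic_point g.2))%:~R :> R.
  case: e g => a b [c d] eP gQ /=; have sp := sep _ _ eP gQ.
  have uk : uniq [:: 1; (index a S).+2%:R; (index b S).+2%:R; (index c S).+2%:R;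
                  (index d S).+2%:R : R].
    by have := separated_all_labels sp; rewrite cons_uniq => /andP[].
  case: ifPn => [/asboolP[s [t [h [hs ht Eh]]]]|/asboolPn nX].
    have [s01 t01 K0] := reg _ _ _ _ _ _ _ eP gQ hs ht Eh.
    have h0 : h != 0.
      apply/eqP => h0; move: Eh; rewrite h0 scale0r => /eqP; rewrite subr_eq0; apply/negP.
      exact: dPQ.
    by rewrite (crossing_hits _ _ _ _ _ s01 t01 h0 Eh K0) opprK.
  have G5 := generic_drop_second (@generic_separated_swap (direction4 u) _ _ _ _ sp).
  have [|-> ->] := hit_eq0 G5; last by rewrite addr0 oppr0.
  by apply/negP => /(crosses_crossing uk u0).
rewrite (eq_big_seq (fun e => - \sum_(g <- sides Q)
    (hit U (generic_point e.1) (generic_point e.2) (generic_point g.1) (generic_point g.2)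
      + hit (opp4 U) (generic_point e.1) (generic_point e.2) (generic_point g.1)
            (generic_point g.2))%:~R)); last first.
  by move=> e eP; rewrite -sumrN; apply: eq_big_seq => g gQ; apply: E.
rewrite sumrN.
have -> : \sum_(e <- sides P) \sum_(g <- sides Q)
    (hit U (generic_point e.1) (generic_point e.2) (generic_point g.1) (generic_point g.2)
      + hit (opp4 U) (generic_point e.1) (generic_point e.2) (generic_point g.1)
            (generic_point g.2))%:~R
   = (link generic_point U (sides P) (sides Q)
      + link generic_point (opp4 U) (sides P) (sides Q))%:~R :> R.
  rewrite /link -big_split /= rmorph_sum; apply: eq_bigr => e _.
  by rewrite -big_split /= rmorph_sum.
by rewrite E1 E2 intrD; set x := _%:~R; lra.
Qed.

Lemma linking_number_chain_link (P Q : seq R3) : sides_disjoint P Q ->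
  separated_chains (sides P) (sides Q) -> sides_proper P -> sides_proper Q ->
  linking_number P Q = - (chain_link (sides P) (sides Q))%:~R.
Proof.
move=> dPQ sep pP pQ; apply: diagram_chain_link => //.
by have [u ru] := regular_direction_exists dPQ pP pQ; apply: xgetI ru.
Qed.

End LinkingNumber.

(** * Linking numbers of cycles as sums over edges *)

Section PathSides.
Variable T : eqType.
Implicit Types (s : seq T) (x y : T).

Definition path_sides s : seq (T * T) := zip s (behead s).

Lemma path_sides_cat s x t :
  path_sides (s ++ x :: t) = path_sides (rcons s x) ++ path_sides (x :: t).
Proof. by elim: s => [|y [|z s] IH] //=; rewrite -cat1s /path_sides /= in IH *; rewrite IH. Qed.

Lemma path_sides_mem s a b : (a, b) \in path_sides s -> a \in s /\ b \in s.
Proof.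
elim: s => [|x [|y s] IH] //; rewrite {1}/path_sides /= inE => /orP[/eqP[-> ->]|/IH[h1 h2]].
  by rewrite !inE !eqxx /= orbT.
by split; apply/orP; right.
Qed.

Lemma path_sides_rev s : path_sides (rev s) = rev [seq (e.2, e.1) | e <- path_sides s].
Proof.
elim: s => [|x [|y s] IH] //.
rewrite (_ : rev [:: x, y & s] = rev s ++ [:: y; x]); last first.
  by rewrite !rev_cons -!cats1 -catA.
by rewrite path_sides_cat -rev_cons IH /path_sides /= rev_cons -cats1.
Qed.

Lemma path_sides_nth x0 s a b : (a, b) \in path_sides s ->
  exists2 i, (i.+1 < size s)%N & a = nth x0 s i /\ b = nth x0 s i.+1.
Proof.
elim: s => [|x [|y s] IH] //; rewrite {1}/path_sides /= inE => /orP[/eqP[-> ->]|/IH[i h1 h2]].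
  by exists 0%N.
by exists i.+1.
Qed.

Lemma zip_rot1 x s : zip (x :: s) (rot 1 (x :: s)) = path_sides (x :: rcons s x).
Proof.
have E : zip ((x :: s) ++ [:: x]) (rcons s x ++ [::]) = zip (x :: s) (rcons s x).
  by rewrite zip_cat ?size_rcons // cats0.
by rewrite rot1_cons -E cats0 cats1.
Qed.

End PathSides.

Section EmbeddedEdges.
Variables (R : realType) (V : finType) (g : rel V) (f : spatial_embedding R g).
Local Notation R3 := 'rV[R]_3.

Definition epts (x y : V) : seq R3 := edge_points (pos f) (bends f) x y.

Lemma path_sides_polypath (s : seq R3) a b : (a, b) \in path_sides s ->
  exists i : nat, forall t, 0 <= t <= 1 ->
    i%:R + t \in polytime s /\ polypath s (i%:R + t) = seg a b t.
Proof.
move=> /(path_sides_nth 0)[i si [-> ->]]; exists i => t /andP[t0 t1]; split.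
  rewrite /polytime in_itv /=; apply/andP; split; first exact: addr_ge0.
  have : i.+1%:R <= (size s).-1%:R :> R by rewrite ler_nat; case: (size s) si.
  by rewrite -natr1; lra.
rewrite /polypath; have [t_1|t_1] := eqVneq t 1.
  have -> : Num.truncn (i%:R + t) = i.+1 by rewrite t_1 natr1 natrK.
  by rewrite t_1 natr1 subrr /seg subr0 subrr !scale1r !scale0r addr0 add0r.
have -> : Num.truncn (i%:R + t) = i.
  by apply: truncn_def; rewrite lerDl t0 -natr1 ltrD2l lt_neqAle t_1.
by rewrite addrC addKr.
Qed.

Lemma path_sides_exists (s : seq R3) a : (1 < size s)%N -> a \in s ->
  exists b, (a, b) \in path_sides s \/ (b, a) \in path_sides s.
Proof.
elim: s => [|x [|y s] IH] // _; rewrite inE => /orP[/eqP->|].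
  by exists y; left; rewrite /path_sides /= inE eqxx.
case: s IH => [_|z s IH aS].
  by rewrite inE => /eqP->; exists x; right; rewrite /path_sides /= inE eqxx.
have [//|b [h|h]] := IH _ aS; exists b; [left|right]; by rewrite /path_sides /= inE h orbT.
Qed.

Lemma epts_proper x y a b : g x y -> (a, b) \in path_sides (epts x y) -> a != b.
Proof.
move=> gxy /path_sides_polypath[i H]; apply/eqP => ab.
have [h0 e0] := H 0 ltac:(lra); have [h1 e1] := H 1 ltac:(lra).
have /= := edge_inj gxy h0 h1; rewrite -/(epts x y) e0 e1 ab.
have -> : seg b b 0 = seg b b 1 :> R3.
  by rewrite /seg subr0 subrr !scale1r !scale0r addr0 add0r.
by move=> /(_ erefl) /addrI /eqP; rewrite eq_sym oner_eq0.
Qed.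

(** For such pairs the points of the two edges are distinct, hence in general position
    after the perturbation. *)
Definition edges_disjoint x y z w := [&& g x y, g z w & [disjoint [:: x; y] & [:: z; w]]].

Lemma epts_seg_disjoint x y z w a b c d (s t : R) : edges_disjoint x y z w ->
  (a, b) \in path_sides (epts x y) -> (c, d) \in path_sides (epts z w) ->
  0 <= s <= 1 -> 0 <= t <= 1 -> seg a b s != seg c d t.
Proof.
move=> /and3P[gxy gzw D] /path_sides_polypath[i Hi] /path_sides_polypath[j Hj] hs ht.
have [h0 <-] := Hi _ hs; have [h1 <-] := Hj _ ht; apply/eqP => E.
(* The vertex provided by [edge_edge] would be common to the two edges. *)
have np : ~~ perm_eq [:: x; y] [:: z; w].
  apply/negP => /perm_mem/(_ x); rewrite !inE eqxx /= => /esym xzw.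
  by have := disjointFr D (mem_head x _); rewrite !inE xzw.
have [v [vxy vzw _]] := edge_edge gxy gzw np h0 h1 E.
by rewrite (disjointFr D vxy) in vzw.
Qed.

Lemma epts_size x y : (1 < size (epts x y))%N.
Proof. by rewrite /= size_rcons. Qed.

Lemma epts_points_disjoint x y z w a c : edges_disjoint x y z w ->
  a \in epts x y -> c \in epts z w -> a != c.
Proof.
move=> D /(path_sides_exists (epts_size x y))[b hb] /(path_sides_exists (epts_size z w))[d hd].
have s0 (p q : R3) : seg p q 0 = p by rewrite /seg subr0 scale1r scale0r addr0.
have s1 (p q : R3) : seg p q 1 = q by rewrite /seg subrr scale1r scale0r add0r.
have [z01 o01] : 0 <= (0 : R) <= 1 /\ 0 <= (1 : R) <= 1 by rewrite !lexx ler01.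
case: hb => hb; case: hd => hd.
- by rewrite -(s0 a b) -(s0 c d); exact: (epts_seg_disjoint D hb hd z01 z01).
- by rewrite -(s0 a b) -(s1 d c); exact: (epts_seg_disjoint D hb hd z01 o01).
- by rewrite -(s1 b a) -(s0 c d); exact: (epts_seg_disjoint D hb hd o01 z01).
- by rewrite -(s1 b a) -(s1 d c); exact: (epts_seg_disjoint D hb hd o01 o01).
Qed.

Definition all_points : seq R3 :=
  flatten [seq flatten [seq epts x y | y <- enum V] | x <- enum V].

Lemma epts_all_points x y : {subset epts x y <= all_points}.
Proof.
move=> a aE; apply/flatten_mapP; exists x; first by rewrite mem_enum.
by apply/flatten_mapP; exists y; rewrite ?mem_enum.
Qed.

Lemma separated_edges x y z w a b c d : edges_disjoint x y z w -> a != b -> c != d ->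
  a \in epts x y -> b \in epts x y -> c \in epts z w -> d \in epts z w ->
  separated all_points a b c d.
Proof.
move=> D ab cd ax bx cz dz; rewrite /separated /=.
rewrite !(epts_all_points ax, epts_all_points bx, epts_all_points cz, epts_all_points dz) !andbT.
have ne p q : p \in epts x y -> q \in epts z w -> p != q by exact: epts_points_disjoint.
by rewrite !inE !negb_or ab cd !ne.
Qed.

(** The blocks of a cycle image list the first vertex and the bends of each edge; the
    last vertex of an edge is the first one of the next block. *)
Lemma walk_sides x (s : seq V) :
  path_sides (rcons (flatten [seq pos f e.1 :: bends f e.1 e.2 | e <- path_sides (x :: s)])
                (pos f (last x s)))
  = flatten [seq path_sides (epts e.1 e.2) | e <- path_sides (x :: s)].
Proof.
elim: s x => [|y s IH] x //.
have -> : path_sides [:: x, y & s] = (x, y) :: path_sides (y :: s) by [].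
rewrite 2!map_cons /=; set W := flatten [seq pos f _ :: _ | _ <- _].
have [t Wt] : exists t, rcons W (pos f (last y s)) = pos f y :: t.
  rewrite /W; case: s {IH W} => [|z s] /=; first by exists [::].
  by rewrite rcons_cat; eexists.
rewrite rcons_cat -cat_cons Wt path_sides_cat -Wt IH.
by rewrite /epts /edge_points rcons_cons.
Qed.

Lemma next_pairs (c : seq V) : uniq c -> [seq (x, next c x) | x <- c] = zip c (rot 1 c).
Proof.
move=> uc; case: c uc => [|x0 c] uc //.
apply: (@eq_from_nth _ (x0, x0)); first by rewrite size_map size_zip size_rot minnn.
move=> i; rewrite size_map => ic; rewrite nth_zip ?size_rot //.
rewrite (nth_map x0) // next_nth mem_nth // index_uniq // rot1_cons nth_rcons.
congr (_, _); move: ic; rewrite /= ltnS leq_eqVlt => /orP[/eqP->|ic].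
  by rewrite ltnn eqxx nth_default.
by rewrite ic; apply: set_nth_default.
Qed.

Lemma cycle_image_sides (c : seq V) : uniq c ->
  sides (cycle_image f c) = flatten [seq path_sides (epts e.1 e.2) | e <- zip c (rot 1 c)].
Proof.
move=> uc; rewrite /cycle_image.
have -> : [seq pos f x :: bends f x (next c x) | x <- c]
        = [seq pos f e.1 :: bends f e.1 e.2 | e <- zip c (rot 1 c)].
  by rewrite -next_pairs // -map_comp.
case: c {uc} => [|x c] //; rewrite zip_rot1 -walk_sides last_rcons /sides.
have [t Wt] : exists t,
    flatten [seq pos f e.1 :: bends f e.1 e.2 | e <- path_sides (x :: rcons c x)]
    = pos f x :: t.
  by case: c => [|y c] /=; eexists.
by rewrite Wt zip_rot1 rcons_cons.
Qed.

Definition edge_link (x y z w : V) : int :=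
  chain_link all_points (path_sides (epts x y)) (path_sides (epts z w)).

Lemma cycle_pair_edge (c : seq V) e : path.cycle g c -> e \in zip c (rot 1 c) -> g e.1 e.2.
Proof.
case: c => [|x c] //; rewrite zip_rot1 /=; case: e => a b /=.
move: (rcons c x) => s; elim: s x => [|y s IH] x //= /andP[gxy pth].
by rewrite {1}/path_sides /= inE => /orP[/eqP[-> ->]|/(IH _ pth)].
Qed.

Lemma pair_mem (c : seq V) e : e \in zip c (rot 1 c) -> e.1 \in c /\ e.2 \in c.
Proof.
move=> h; have := map_f fst h; have := map_f snd h.
by rewrite -/(unzip1 _) -/(unzip2 _) unzip1_zip ?unzip2_zip ?size_rot // mem_rot.
Qed.

Lemma cycle_sides_edge (c : seq V) e : is_cycle g c -> e \in sides (cycle_image f c) ->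
  exists x y, [/\ g x y, x \in c, y \in c & e \in path_sides (epts x y)].
Proof.
move=> /and3P[_ cyc uc]; rewrite cycle_image_sides // => /flatten_mapP[[x y] xy eE].
have gxy := cycle_pair_edge cyc xy; have [xc yc] := pair_mem xy.
by exists x, y.
Qed.

(** Since [chain_link] uses the same apex and the same perturbed points for all polygons,
    the linking number of any two cycles is a sum over their pairs of edges. *)
Lemma lk_edge_link (c c' : seq V) : is_cycle g c -> is_cycle g c' -> [disjoint c & c'] ->
  lk f c c' = - (\sum_(e <- zip c (rot 1 c)) \sum_(e' <- zip c' (rot 1 c'))
                   edge_link e.1 e.2 e'.1 e'.2)%:~R.
Proof.
move=> cc cc' D.
have disj x y z w : g x y -> g z w -> x \in c -> y \in c -> z \in c' -> w \in c' ->
    edges_disjoint x y z w.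
  move=> gxy gzw xc yc zc wc; rewrite /edges_disjoint gxy gzw /=.
  apply/pred0P => v; apply/negbTE/negP => /andP[]; rewrite /= !inE => vxy vzw.
  have vc : v \in c by case/orP: vxy => /eqP->.
  have := disjointFr D vc; case/orP: vzw => /eqP->; by rewrite ?zc ?wc.
rewrite /lk (@linking_number_chain_link _ all_points); last 4 first.
- move=> a b p q s t /(cycle_sides_edge cc)[x [y [gxy xc yc h]]].
  move=> /(cycle_sides_edge cc')[z [w [gzw zc wc h']]].
  exact: epts_seg_disjoint (disj _ _ _ _ gxy gzw xc yc zc wc) h h'.
- move=> [a b] [p q] /(cycle_sides_edge cc)[x [y [gxy xc yc h]]].
  move=> /(cycle_sides_edge cc')[z [w [gzw zc wc h']]] /=.
  have [ha hb] := path_sides_mem h; have [hp hq] := path_sides_mem h'.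
  apply: separated_edges ha hb hp hq; first exact: disj.
    exact: epts_proper gxy h.
  exact: epts_proper gzw h'.
- by move=> a b /(cycle_sides_edge cc)[x [y [gxy _ _ h]]]; exact: epts_proper gxy h.
- by move=> a b /(cycle_sides_edge cc')[x [y [gxy _ _ h]]]; exact: epts_proper gxy h.
congr (- _%:~R); have [uc uc'] : uniq c /\ uniq c' by move: cc cc' => /and3P[_ _ ?] /and3P[_ _ ?].
rewrite /chain_link /link !cycle_image_sides // big_flatten big_map; apply: eq_bigr => e _.
under eq_bigr do rewrite big_flatten big_map.
by rewrite exchange_big.
Qed.

Lemma separated_path_sides x y z w : edges_disjoint x y z w ->
  separated_chains all_points (path_sides (epts x y)) (path_sides (epts z w)).
Proof.
move=> D [a b] [p q] h h'; have [ha hb] := path_sides_mem h; have [hp hq] := path_sides_mem h'.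
case/and3P: (D) => gxy gzw _.
by apply: separated_edges D _ _ ha hb hp hq; [exact: epts_proper gxy h|exact: epts_proper gzw h'].
Qed.

Lemma epts_sym x y : g x y -> epts y x = rev (epts x y).
Proof.
by move=> gxy; rewrite /epts /edge_points (bends_sym f gxy) rev_cons rev_rcons rcons_cons.
Qed.

Lemma separated_generic5 S (a b c d : R3) : separated S a b c d ->
  generic [:: apex R; generic_point S a; generic_point S b; generic_point S c; generic_point S d].
Proof. by move=> /(@generic_separated _ _ (0, 0, 0, 0))/generic_drop_second. Qed.

Lemma edge_link_swapl x y z w : edges_disjoint x y z w -> edge_link y x z w = - edge_link x y z w.
Proof.
move=> D; case/and3P: (D) => gxy _ _.
rewrite /edge_link /chain_link /link epts_sym // path_sides_rev.
rewrite (perm_big _ (permEl (perm_rev _))) /= big_map -sumrN; apply: eq_big_seq => e eP.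
rewrite -sumrN; apply: eq_big_seq => h hP /=.
by apply: hit_swapl; apply: separated_generic5; apply: (separated_path_sides D).
Qed.

Lemma edge_link_swapr x y z w : edges_disjoint x y z w -> edge_link x y w z = - edge_link x y z w.
Proof.
move=> D; case/and3P: (D) => _ gzw _.
rewrite /edge_link /chain_link /link (epts_sym gzw) path_sides_rev.
rewrite -sumrN; apply: eq_big_seq => e eP.
rewrite (perm_big _ (permEl (perm_rev _))) /= big_map -sumrN; apply: eq_big_seq => h hP /=.
by apply: hit_swapr; apply: separated_generic5; apply: (separated_path_sides D).
Qed.

End EmbeddedEdges.

(** * The sum over the ten pairs of triangles on six vertices is odd *)

(** Parities are elements of the ring [bool], in which addition is exclusive or. *)
Definition triangle_pair_parity (F : nat -> nat -> nat -> nat -> bool) x y z x' y' z' : bool :=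
  F x y x' y' + F x y y' z' + F x y z' x'
  + F y z x' y' + F y z y' z' + F y z z' x'
  + F z x x' y' + F z x y' z' + F z x z' x'.

(** The fifteen pairs of disjoint edges of the complete graph on the vertices 1, ..., 5. *)
Definition pentagon_sum (F : nat -> nat -> nat -> nat -> bool) : bool :=
  F 1 2 3 4 + F 1 2 3 5 + F 1 2 4 5 + F 1 3 2 4 + F 1 3 2 5
  + F 1 3 4 5 + F 1 4 2 3 + F 1 4 2 5 + F 1 4 3 5 + F 1 5 2 3
  + F 1 5 2 4 + F 1 5 3 4 + F 2 3 4 5 + F 2 4 3 5 + F 2 5 3 4.

Definition distinct6 (i j k l : nat) :=
  uniq [:: i; j; k; l] && all (fun m => m < 6)%N [:: i; j; k; l].

Lemma addxx (x : bool) : x + x = 0. Proof. by case: x. Qed.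

(** Let vertex 0 be in the first triangle of each of the ten splittings.  A pair of
    disjoint edges with 0 in the first one occurs in two splittings and cancels; what is
    left are the ordered pairs of disjoint edges among the five other vertices. *)
Lemma ten_triangle_pairs F :
  (forall i j k l, distinct6 i j k l -> F j i k l = F i j k l) ->
  (forall k l i j, distinct6 i j k l -> F i j l k = F i j k l) ->
  triangle_pair_parity F 0 1 2 3 4 5
  + triangle_pair_parity F 0 3 2 1 4 5
  + triangle_pair_parity F 0 4 2 3 1 5
  + triangle_pair_parity F 0 5 2 3 4 1
  + triangle_pair_parity F 0 1 3 2 4 5
  + triangle_pair_parity F 0 1 4 3 2 5
  + triangle_pair_parity F 0 1 5 3 4 2
  + triangle_pair_parity F 0 3 4 1 2 5
  + triangle_pair_parity F 0 3 5 1 4 2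
  + triangle_pair_parity F 0 4 5 3 1 2
  = pentagon_sum (fun i j k l => F i j k l + F k l i j).
Proof.
move=> Fl Fr; rewrite /triangle_pair_parity /pentagon_sum.
rewrite ?(Fl 0 1) ?(Fl 0 2) ?(Fl 0 3) ?(Fl 0 4) ?(Fl 0 5) ?(Fl 1 2) ?(Fl 1 3) ?(Fl 1 4) ?(Fl 1 5)
  ?(Fl 2 3) ?(Fl 2 4) ?(Fl 2 5) ?(Fl 3 4) ?(Fl 3 5) ?(Fl 4 5)
  ?(Fr 0 1) ?(Fr 0 2) ?(Fr 0 3) ?(Fr 0 4) ?(Fr 0 5) ?(Fr 1 2) ?(Fr 1 3) ?(Fr 1 4) ?(Fr 1 5)
  ?(Fr 2 3) ?(Fr 2 4) ?(Fr 2 5) ?(Fr 3 4) ?(Fr 3 5) ?(Fr 4 5) //.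
(* [Qi] collects the pairs that contain the edge 0 i; each of them occurs twice. *)
pose Q1 := (F 0 1 2 3 + F 0 1 2 4 + F 0 1 2 5 + F 0 1 3 4 + F 0 1 3 5 + F 0 1 4 5).
pose Q2 := (F 0 2 1 3 + F 0 2 1 4 + F 0 2 1 5 + F 0 2 3 4 + F 0 2 3 5 + F 0 2 4 5).
pose Q3 := (F 0 3 1 2 + F 0 3 1 4 + F 0 3 1 5 + F 0 3 2 4 + F 0 3 2 5 + F 0 3 4 5).
pose Q4 := (F 0 4 1 2 + F 0 4 1 3 + F 0 4 1 5 + F 0 4 2 3 + F 0 4 2 5 + F 0 4 3 5).
pose Q5 := (F 0 5 1 2 + F 0 5 1 3 + F 0 5 1 4 + F 0 5 2 3 + F 0 5 2 4 + F 0 5 3 4).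
rewrite -[RHS]addr0 -(addxx (Q1 + Q2 + Q3 + Q4 + Q5)) /Q1 /Q2 /Q3 /Q4 /Q5; ring.
Qed.

Lemma pentagon_sum_by_four F : pentagon_sum F =
    (F 2 3 4 5 + F 2 4 3 5 + F 2 5 3 4)
    + (F 1 3 4 5 + F 1 4 3 5 + F 1 5 3 4)
    + (F 1 2 4 5 + F 1 4 2 5 + F 1 5 2 4)
    + (F 1 2 3 5 + F 1 3 2 5 + F 1 5 2 3)
    + (F 1 2 3 4 + F 1 3 2 4 + F 1 4 2 3).
Proof. by rewrite /pentagon_sum; ring. Qed.

Lemma pentagon_sum_ext F G : (forall i j k l, distinct6 i j k l -> F i j k l = G i j k l) ->
  pentagon_sum F = pentagon_sum G.
Proof. by move=> FG; rewrite /pentagon_sum !FG. Qed.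

(** An edge i j is disjoint from exactly the three edges of the triangle on the remaining
    vertices, over which [F i j] sums to zero. *)
Lemma pentagon_sum_cocycle F G :
  (forall i j k l m, uniq [:: i; j; k; l; m] && all (fun m => m < 6)%N [:: i; j; k; l; m] ->
     F i j k l + F i j l m + F i j k m = 0) ->
  pentagon_sum (fun i j k l => G i j k l + (F i j k l + F k l i j)) = pentagon_sum G.
Proof.
move=> F0; transitivity (pentagon_sum G + (
  (F 1 2 3 4 + F 1 2 4 5 + F 1 2 3 5)
  + (F 1 3 2 4 + F 1 3 4 5 + F 1 3 2 5)
  + (F 1 4 2 3 + F 1 4 3 5 + F 1 4 2 5)
  + (F 1 5 2 3 + F 1 5 3 4 + F 1 5 2 4)
  + (F 2 3 1 4 + F 2 3 4 5 + F 2 3 1 5)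
  + (F 2 4 1 3 + F 2 4 3 5 + F 2 4 1 5)
  + (F 2 5 1 3 + F 2 5 3 4 + F 2 5 1 4)
  + (F 3 4 1 2 + F 3 4 2 5 + F 3 4 1 5)
  + (F 3 5 1 2 + F 3 5 2 4 + F 3 5 1 4)
  + (F 4 5 1 2 + F 4 5 2 3 + F 4 5 1 3))).
  by rewrite /pentagon_sum; ring.
by rewrite !F0 // !addr0.
Qed.

(** The number modulo 2 of crossings between the three pairs of opposite edges on four
    points, from the orientations of the triples that omit the first, second, third and
    fourth point. *)
Definition four_crossings (t1 t2 t3 t4 : bool) : bool :=
  [&& t1 != t2, t2 == t3 & t3 != t4] + [&& t1 == t2, t2 == t3 & t3 == t4]
  + [&& t1 != t4, t4 != t2 & t2 != t3].

(** Five points of the plane in general position, where [sijk] is the orientation of the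
    points i, j, k: the straight drawing of the complete graph on them has an odd number
    of crossings of disjoint edges. *)
Definition pentagon_check : sign_fun 10 :=
  fun s123 s124 s125 s134 s135 s145 s234 s235 s245 s345 =>
  plucker_signs s123 s145 s124 s135 s125 s134 ==>
  plucker_signs s123 s245 s124 s235 s125 s234 ==>
  plucker_signs s123 s345 s134 s235 s135 s234 ==>
  plucker_signs s124 s345 s134 s245 s145 s234 ==>
  (four_crossings s345 s245 s235 s234
  + four_crossings s345 s145 s135 s134
  + four_crossings s245 s145 s125 s124
  + four_crossings s235 s135 s125 s123
  + four_crossings s234 s134 s124 s123).

Lemma pentagon_checkP : valid_signs pentagon_check.
Proof. by apply: all_signsP; vm_compute. Qed.

Lemma oppb (x : bool) : - x = x. Proof. by case: x. Qed.

Lemma natr_bool n : (n%:R : bool) = odd n.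
Proof. by elim: n => //= n IH; rewrite -natr1 IH; case: (odd n). Qed.

Lemma intr_bool (z : int) : (z%:~R : bool) = odd `|z|.
Proof. by case: z => n; rewrite ?NegzE ?intrN ?oppb ?abszN -pmulrn natr_bool. Qed.

Section CrossingParity.
Variables (R : realType) (S : seq 'rV[R]_3).
Local Notation R3 := 'rV[R]_3.
Local Notation O := (apex R).
Local Notation W := (generic_point S).
Implicit Types P Q : seq (R3 * R3).

(** The number modulo 2 of crossings of [P] and [Q] in the projection from [apex],
    whichever is in front. *)
Definition crossing_parity P Q : bool := (chain_link S P Q + chain_link S Q P)%:~R.

Lemma crossing_parityC P Q : crossing_parity P Q = crossing_parity Q P.
Proof. by rewrite /crossing_parity addrC. Qed.

Lemma crossing_parity_cat P P' Q :
  crossing_parity (P ++ P') Q = crossing_parity P Q + crossing_parity P' Q.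
Proof.
rewrite /crossing_parity /chain_link /link big_cat /=.
under [X in (_ + X)%:~R]eq_bigr do rewrite big_cat /=.
by rewrite big_split /= -intrD addrACA.
Qed.

Lemma separated_chains_generic P Q v : separated_chains S P Q ->
  generic_chains W [:: O; perturb (v, 1)] P Q.
Proof. by move=> sp e g eP gQ; apply: generic_separated; apply: sp. Qed.

(** The two summands are equal by [link_sym]: closed curves in the plane cross an even
    number of times. *)
Lemma closed_crossing_parity P Q : closed_chain P -> closed_chain Q ->
  separated_chains S P Q -> crossing_parity P Q = 0.
Proof.
move=> cP cQ sp; have G := separated_chains_generic (v := (0, 0, 0, 0)) sp.
rewrite /crossing_parity /chain_link (link_sym cP cQ G) ?intrD ?addxx //.
by move=> e g eP gQ; apply: generic_drop_second (G e g eP gQ).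
Qed.

Lemma crossing_parity_flip P a b :
  (forall e, e \in P -> separated S e.1 e.2 a b) ->
  crossing_parity P [:: (b, a)] = crossing_parity P [:: (a, b)].
Proof.
move=> sp; have G e : e \in P -> generic [:: O; W e.1; W e.2; W a; W b].
  by move=> /sp /(@generic_separated _ _ (0, 0, 0, 0))/generic_drop_second.
have G' e : e \in P -> generic [:: O; W a; W b; W e.1; W e.2].
  move=> /sp sp'; apply: (@generic_drop_second _ _ (perturb (0, 0, 0, 0, 1))).
  apply: generic_separated; move: sp' => /andP[u al]; apply/andP; split.
    by rewrite (uniq_catC [:: a; b] [:: e.1; e.2]).
  by move: al => /= /and5P[-> -> -> ->].
rewrite /crossing_parity /chain_link (link_flipr G) (link_flipl G').
by rewrite -opprD intrN oppb.
Qed.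

Lemma crossing_parity1 a b c d : separated S a b c d ->
  crossing_parity [:: (a, b)] [:: (c, d)] = crosses O (W a) (W b) (W c) (W d).
Proof.
move=> sp; have G := generic_drop_second (@generic_separated _ S (0, 0, 0, 0) _ _ _ _ sp).
by rewrite /crossing_parity /chain_link !link1 -(hit_crosses G) intrD !intr_bool.
Qed.

End CrossingParity.

Section CompleteGraph.
Variables (R : realType) (V : finType) (g : rel V) (f : spatial_embedding R g).
Hypothesis g_complete : forall x y, x != y -> g x y.
Local Notation R3 := 'rV[R]_3.
Local Notation S := (all_points f).
Local Notation W := (generic_point S).
Local Notation O := (apex R).
Variable vs : seq V.
Hypotheses (uvs : uniq vs) (svs : size vs = 6%N).
Variable x0 : V.
Local Notation v := (nth x0 vs).

Lemma distinct6_disjoint i j k l : distinct6 i j k l ->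
  edges_disjoint g (v i) (v j) (v k) (v l).
Proof.
rewrite /distinct6 /= !inE !negb_or !andbT.
move=> /andP[/and3P[/and3P[ij ik il] /andP[jk jl] kl] /and4P[i6 j6 k6 l6]].
rewrite /edges_disjoint !g_complete ?nth_uniq ?svs //=.
by rewrite disjoint_has /= !inE !nth_uniq ?svs // (negbTE ik) (negbTE il) (negbTE jk) (negbTE jl).
Qed.

Definition link_parity i j k l : bool := (edge_link f (v i) (v j) (v k) (v l))%:~R.

Definition straight i j : seq (R3 * R3) := [:: (pos f (v i), pos f (v j))].
Definition bent i j : seq (R3 * R3) := path_sides (epts f (v i) (v j)).
(** An edge of the embedding, closed up by the straight segment between its ends. *)
Definition loop i j : seq (R3 * R3) := bent i j ++ straight j i.

Definition on_edge i j (P : seq (R3 * R3)) := forall e, e \in P ->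
  [/\ e.1 != e.2, e.1 \in epts f (v i) (v j) & e.2 \in epts f (v i) (v j)].

Lemma on_edge_separated i j k l P Q : distinct6 i j k l -> on_edge i j P -> on_edge k l Q ->
  separated_chains S P Q.
Proof.
move=> D oP oQ e h /oP[ne e1 e2] /oQ[nh h1 h2].
exact: separated_edges (distinct6_disjoint D) ne nh e1 e2 h1 h2.
Qed.

Lemma distinct6_neq i j k l : distinct6 i j k l -> v i != v j.
Proof.
rewrite /distinct6 /= !inE !negb_or => /andP[/andP[/and3P[ij _ _] _] /and3P[i6 j6 _]].
by rewrite nth_uniq ?svs.
Qed.

Lemma pos_epts i j : pos f (v i) \in epts f (v i) (v j) /\ pos f (v j) \in epts f (v i) (v j).
Proof.
by split; rewrite /epts /edge_points inE ?mem_rcons ?inE eqxx ?orbT.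
Qed.

Lemma straight_on_edge i j : v i != v j -> on_edge i j (straight i j).
Proof.
move=> ne e; rewrite inE => /eqP->; have [? ?] := pos_epts i j; split=> //=.
by rewrite (inj_eq (@pos_inj _ _ _ f)).
Qed.

Lemma straight_rev_on_edge i j : v i != v j -> on_edge i j (straight j i).
Proof.
move=> ne e; rewrite inE => /eqP->; have [? ?] := pos_epts i j; split=> //=.
by rewrite (inj_eq (@pos_inj _ _ _ f)) eq_sym.
Qed.

Lemma bent_on_edge i j : v i != v j -> on_edge i j (bent i j).
Proof.
move=> ne [a b] h; have [? ?] := path_sides_mem h; split=> //.
exact: epts_proper (g_complete ne) h.
Qed.

Lemma loop_on_edge i j : v i != v j -> on_edge i j (loop i j).
Proof.
move=> ne e; rewrite mem_cat => /orP[]; first exact: bent_on_edge.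
exact: straight_rev_on_edge.
Qed.

Lemma path_sides_telescope (T : eqType) (x : T) s (phi : T -> int) :
  \sum_(e <- path_sides (x :: s)) (phi e.2 - phi e.1) = phi (last x s) - phi x.
Proof.
elim: s x => [|y s IH] x; first by rewrite /path_sides /= big_nil subrr.
have -> : path_sides [:: x, y & s] = (x, y) :: path_sides (y :: s) by [].
by rewrite big_cons IH /= addrC addrA subrK.
Qed.

Lemma loop_closed i j : closed_chain (loop i j).
Proof.
move=> phi; rewrite big_cat big_seq1 /= path_sides_telescope last_rcons.
by rewrite addrA subrK subrr.
Qed.

Lemma triangle_closed i j k : closed_chain (straight i j ++ straight j k ++ straight k i).
Proof. by move=> phi; rewrite !big_cat !big_seq1 /=; lia. Qed.

(** The effect of straightening the edge i j on its crossings with the segment k l. *)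
Definition deviation i j k l := crossing_parity S (loop i j) (straight k l).
Definition flat i j k l := crossing_parity S (straight i j) (straight k l).

Lemma distinct6C i j k l : distinct6 i j k l -> distinct6 k l i j.
Proof.
rewrite /distinct6 (uniq_catC [:: i; j] [:: k; l]) => /andP[-> /=].
by move=> /and4P[-> -> -> /andP[-> _]].
Qed.

Lemma crossing_parity_straight_flip i j k l P : distinct6 i j k l -> on_edge i j P ->
  crossing_parity S P (straight l k) = crossing_parity S P (straight k l).
Proof.
move=> D oP; apply: crossing_parity_flip => e eP.
have kl := distinct6_neq (distinct6C D).
exact: (on_edge_separated D oP (straight_on_edge kl) eP (mem_head _ _)).
Qed.

Lemma bent_decompose i j k l Q : distinct6 i j k l -> on_edge k l Q ->
  crossing_parity S (bent i j) Q
  = crossing_parity S (loop i j) Q + crossing_parity S (straight i j) Q.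
Proof.
move=> D oQ; rewrite crossing_parity_cat.
have -> : crossing_parity S (straight j i) Q = crossing_parity S (straight i j) Q.
  rewrite ![crossing_parity S _ Q]crossing_parityC.
  exact: crossing_parity_straight_flip (distinct6C D) oQ.
by rewrite -addrA addxx addr0.
Qed.

(** Each of the two edges is the sum of its loop and of the straight segment; the two
    loops do not contribute, being closed. *)
Lemma link_parity_decompose i j k l : distinct6 i j k l ->
  link_parity i j k l + link_parity k l i j
  = flat i j k l + (deviation i j k l + deviation k l i j).
Proof.
move=> D; have D' := distinct6C D.
have ij := distinct6_neq D; have kl := distinct6_neq D'.
rewrite /link_parity -intrD -/(crossing_parity S (bent i j) (bent k l)).
rewrite (bent_decompose D (bent_on_edge kl)) /flat /deviation.
rewrite ![crossing_parity S _ (bent k l)]crossing_parityC.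
rewrite (bent_decompose D' (loop_on_edge ij)) (bent_decompose D' (straight_on_edge ij)).
rewrite (closed_crossing_parity (loop_closed k l) (loop_closed i j)); last first.
  exact: on_edge_separated D' (loop_on_edge kl) (loop_on_edge ij).
rewrite [crossing_parity S (straight k l) (loop i j)]crossing_parityC.
rewrite [crossing_parity S (straight k l) (straight i j)]crossing_parityC.
by ring.
Qed.

(** A loop is closed, and so is a triangle of straight segments: they cross evenly. *)
Lemma deviation_cocycle i j k l m :
  uniq [:: i; j; k; l; m] && all (fun m => m < 6)%N [:: i; j; k; l; m] ->
  deviation i j k l + deviation i j l m + deviation i j k m = 0.
Proof.
move=> H.
have [D1 D2 D3] : [/\ distinct6 i j k l, distinct6 i j l m & distinct6 i j k m].
  split; move: H; rewrite /distinct6 /= !inE !negb_or;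
    do ![case: (_ == _) => //=]; by do ![case: (_ < _)%N => //=].
have oL := loop_on_edge (distinct6_neq D1).
have -> : deviation i j k m = crossing_parity S (loop i j) (straight m k).
  by rewrite /deviation (crossing_parity_straight_flip D3 oL).
rewrite /deviation ![crossing_parity S (loop i j) _]crossing_parityC.
rewrite -addrA -!crossing_parity_cat.
apply: closed_crossing_parity; [exact: triangle_closed|exact: loop_closed|].
move=> e h; rewrite !(@mem_cat _ e) => /or3P[] eE hL.
- exact: (on_edge_separated (distinct6C D1)
    (straight_on_edge (distinct6_neq (distinct6C D1))) oL eE hL).
- exact: (on_edge_separated (distinct6C D2)
    (straight_on_edge (distinct6_neq (distinct6C D2))) oL eE hL).
- exact: (on_edge_separated (distinct6C D3)
    (straight_rev_on_edge (distinct6_neq (distinct6C D3))) oL eE hL).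
Qed.

Lemma flat_crosses i j k l : distinct6 i j k l ->
  flat i j k l = crosses O (W (pos f (v i))) (W (pos f (v j)))
                           (W (pos f (v k))) (W (pos f (v l))).
Proof.
move=> D; have D' := distinct6C D; apply: crossing_parity1.
exact: (on_edge_separated D (straight_on_edge (distinct6_neq D))
  (straight_on_edge (distinct6_neq D')) (mem_head _ _) (mem_head _ _)).
Qed.

End CompleteGraph.

Section Pentagon.
Variable R : realFieldType.

Lemma four_crossingsE (o a b c d : vec4 {poly R}) :
  det4 o b c d != 0 -> det4 o a c d != 0 -> det4 o a b d != 0 -> det4 o a b c != 0 ->
  (crosses o a b c d : bool) + crosses o a c b d + crosses o a d b c
  = four_crossings (orient o b c d) (orient o a c d) (orient o a b d) (orient o a b c).
Proof.
move=> g1 g2 g3 g4; rewrite /crosses /four_crossings /orient.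
rewrite (det4_swap23 o b c d) (det4_swap34 o a b c) (det4_rot o b c d).
rewrite (det4_swap34 o a c d) (det4_swap34 o a b d) !iposN //.
by do !case: (ipos _).
Qed.

Lemma pentagon_crossings (o : vec4 {poly R}) (w : nat -> vec4 {poly R}) :
  (forall i j k, (0 < i < j)%N -> (j < k < 6)%N -> det4 o (w i) (w j) (w k) != 0) ->
  pentagon_sum (fun i j k l => crosses o (w i) (w j) (w k) (w l)) = true.
Proof.
move=> N.
have n123 := N 1 2 3 isT isT.
have n124 := N 1 2 4 isT isT.
have n125 := N 1 2 5 isT isT.
have n134 := N 1 3 4 isT isT.
have n135 := N 1 3 5 isT isT.
have n145 := N 1 4 5 isT isT.
have n234 := N 2 3 4 isT isT.
have n235 := N 2 3 5 isT isT.
have n245 := N 2 4 5 isT isT.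
have n345 := N 3 4 5 isT isT.
rewrite pentagon_sum_by_four !four_crossingsE //.
have := pentagon_checkP
  (orient o (w 1) (w 2) (w 3))
  (orient o (w 1) (w 2) (w 4))
  (orient o (w 1) (w 2) (w 5))
  (orient o (w 1) (w 3) (w 4))
  (orient o (w 1) (w 3) (w 5))
  (orient o (w 1) (w 4) (w 5))
  (orient o (w 2) (w 3) (w 4))
  (orient o (w 2) (w 3) (w 5))
  (orient o (w 2) (w 4) (w 5))
  (orient o (w 3) (w 4) (w 5)).
rewrite /pentagon_check.
have [gp0 [gp1 [gp2 [gp3 _]]]] := grassmann_plucker o (w 1) (w 2) (w 3) (w 4) (w 5).
by do 4 (move/implyP=> H; have {}H : _ := H ltac:(exact: plucker_signsP); move: H).
Qed.

End Pentagon.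

Section SixVertices.
Variables (R : realType) (V : finType) (g : rel V) (f : spatial_embedding R g).
Hypothesis g_complete : forall x y, x != y -> g x y.
Variables (vs : seq V) (x0 : V).
Hypotheses (uvs : uniq vs) (svs : size vs = 6%N).
Local Notation v := (nth x0 vs).
Local Notation S := (all_points f).
Local Notation W := (generic_point S).
Local Notation O := (apex R).

Lemma flat_pentagon_sum : pentagon_sum (flat f vs x0) = true.
Proof.
rewrite (@pentagon_sum_ext _ (fun i j k l => crosses O (W (pos f (v i))) (W (pos f (v j)))
                           (W (pos f (v k))) (W (pos f (v l))))); last first.
  by move=> i j k l; apply: flat_crosses.
apply: (@pentagon_crossings _ O (fun i => W (pos f (v i)))) => i j k ij jk.
apply: (@det4_perturb_neq0 _ (_, _) (_, _) (_, _) (_, _)) => /=.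
have inS m : pos f (v m) \in S.
  by apply: (@epts_all_points _ _ _ f (v m) (v m)); rewrite /epts inE eqxx.
have ne m m' : (m < m')%N -> (m' < 6)%N -> pos f (v m) != pos f (v m').
  move=> h h'; rewrite (inj_eq (@pos_inj _ _ _ f)) nth_uniq ?svs ?(ltn_trans h) //.
  by rewrite ltn_eqF.
have n0 (m : nat) : 0 != m.+2%:R :> R by rewrite eq_sym pnatr_eq0.
by rewrite !inE !negb_or !n0 !(index_inj_nat, inS, ne) //; lia.
Qed.

Definition trilink x y z x' y' z' : int :=
  \sum_(e <- [:: (x, y); (y, z); (z, x)]) \sum_(e' <- [:: (x', y'); (y', z'); (z', x')])
     edge_link f e.1 e.2 e'.1 e'.2.

Lemma trilink_parity i j k l m n :
  ((trilink (v i) (v j) (v k) (v l) (v m) (v n))%:~R : bool)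
  = triangle_pair_parity (link_parity f vs x0) i j k l m n.
Proof.
rewrite /trilink /triangle_pair_parity /link_parity !(big_cons, big_nil) /= !addr0 !intrD; ring.
Qed.

(** The theorem of Conway, Gordon and Sachs.  Modulo 2 the sum is the number of crossings
    of disjoint edges of the complete graph on five of the vertices.  It does not change
    when the edges are straightened, and it is odd for straight edges. *)
Lemma trilinks_sum_odd :
  let t i j k l m n : int := trilink (v i) (v j) (v k) (v l) (v m) (v n) in
  (((t 0 1 2 3 4 5)%N + (t 0 3 2 1 4 5)%N + (t 0 4 2 3 1 5)%N
    + (t 0 5 2 3 4 1)%N + (t 0 1 3 2 4 5)%N
    + (t 0 1 4 3 2 5)%N + (t 0 1 5 3 4 2)%N
    + (t 0 3 4 1 2 5)%N + (t 0 3 5 1 4 2)%N + (t 0 4 5 3 1 2)%N)%:~R : bool) = true.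
Proof.
move=> t; rewrite /t !intrD !trilink_parity ten_triangle_pairs.
- rewrite (@pentagon_sum_ext _ (fun i j k l => flat f vs x0 i j k l
     + (deviation f vs x0 i j k l + deviation f vs x0 k l i j))); last first.
    by move=> i j k l D; apply: link_parity_decompose.
  by rewrite pentagon_sum_cocycle ?flat_pentagon_sum // => *; apply: deviation_cocycle.
- move=> i j k l D; rewrite /link_parity edge_link_swapl ?intrN ?oppb //.
  exact: distinct6_disjoint D.
- move=> k l i j D; rewrite /link_parity edge_link_swapr ?intrN ?oppb //.
  exact: distinct6_disjoint D.
Qed.

End SixVertices.

(** * Second moments over random permutations *)

Section Transitivity.
Variable T : finType.
Implicit Types (D : {set T}) (s t : seq T).

Lemma tperm_on_set D x y : x \in D -> y \in D -> perm_on D (tperm x y).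
Proof.
move=> xD yD; apply/fintype.subsetP => z; rewrite inE.
by case: tpermP => [->|->|] //; rewrite eqxx.
Qed.

Lemma perm_on_extend D s t : uniq s -> uniq t -> size s = size t ->
  {subset s <= D} -> {subset t <= D} ->
  exists2 tau : {perm T}, perm_on D tau & map tau s = t.
Proof.
elim: s t => [|x s IH] [|y t] //=; first by exists 1%g; rewrite ?perm_on1.
move=> /andP[xs us] /andP[yt ut] [sz] sD tD.
have [|z zs|tau tD' mt] := IH t us ut sz _ _; [by move=> z zs; apply: sD; rewrite inE zs orbT
  |by apply: tD; rewrite inE zs orbT|].
(* By induction [tau] maps the tails; the transposition then moves [tau x] to [y] and
   fixes the tail of [t]. *)
have txD : tau x \in D by rewrite (perm_closed _ tD') sD ?mem_head.
exists (tau * tperm (tau x) y)%g.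
  by apply: perm_onM => //; apply: tperm_on_set => //; apply: tD; rewrite mem_head.
congr (_ :: _); first by rewrite permM tpermL.
rewrite -[RHS]mt; apply/eq_in_map => z zs; rewrite permM tpermD //.
  by apply: contraNneq xs => /perm_inj->.
by apply: contraNneq yt => ->; rewrite -mt map_f.
Qed.

End Transitivity.

Section SecondMoment.
Variables (A : comNzRingType) (T : finType) (D : {set T}).
Variable H : {perm T} -> T -> T -> A.
Hypothesis H_equi : forall tau s x y, perm_on D tau -> x \in D -> y \in D ->
  H (tau * s)%g x y = H s (tau x) (tau y).
Hypothesis H_anti : forall s x y, x \in D -> y \in D -> x != y -> H s y x = - H s x y.
Hypothesis no_torsion : forall a : A, a = - a -> a = 0.

(** Up to a factor, the correlation of two edges of a random placement. *)
Definition corr x y z w : A := \sum_s H s x y * H s z w.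

Lemma corr_perm tau x y z w : perm_on D tau ->
  x \in D -> y \in D -> z \in D -> w \in D ->
  corr (tau x) (tau y) (tau z) (tau w) = corr x y z w.
Proof.
move=> tD xD yD zD wD; rewrite /corr [RHS](reindex_inj (mulgI tau)) /=.
by apply: eq_bigr => s _; rewrite !H_equi.
Qed.

Lemma corr_path x y z x' y' z' : uniq [:: x; y; z] -> uniq [:: x'; y'; z'] ->
  {subset [:: x; y; z] <= D} -> {subset [:: x'; y'; z'] <= D} ->
  corr x y y z = corr x' y' y' z' /\ corr x y x y = corr x' y' x' y'.
Proof.
move=> u u' sD sD'; have [tau tD [<- <- <-]] := perm_on_extend u u' erefl sD sD'.
have [xD yD zD] : [/\ x \in D, y \in D & z \in D].
  by split; apply: sD; rewrite !inE eqxx ?orbT.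
by rewrite !corr_perm.
Qed.

(** Exchanging the ends of the second edge changes the sign of its contribution only. *)
Lemma corr_disjoint x y z w : uniq [:: x; y; z; w] -> {subset [:: x; y; z; w] <= D} ->
  corr x y z w = 0.
Proof.
move=> u sD; have [xD yD zD wD] : [/\ x \in D, y \in D, z \in D & w \in D].
  by split; apply: sD; rewrite !inE eqxx ?orbT.
move: u; rewrite /= !inE !negb_or => /and4P[/and3P[xy xz xw] /andP[yz yw] zw _].
apply: no_torsion; rewrite -[LHS](@corr_perm (tperm z w)) ?tperm_on_set //.
rewrite !tpermL !tpermR !tpermD 1?eq_sym // /corr -sumrN.
by apply: eq_bigr => s _; rewrite (H_anti _ zD wD zw) mulrN.
Qed.

(** After expanding the square, the pairs of disjoint edges of the closed walk cancel; what
    remains are the equal and the consecutive pairs, one and two for each edge, and their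
    correlations do not depend on the walk. *)
Lemma second_moment (C : finType) (s : {perm C}) (c : C -> T) x y z :
  injective c -> (forall i, c i \in D) ->
  (forall i, s i != i) -> (forall i, s (s i) != i) ->
  uniq [:: x; y; z] -> {subset [:: x; y; z] <= D} ->
  \sum_t (\sum_i H t (c i) (c (s i))) ^+ 2
  = (corr x y x y + corr x y y z *+ 2) *+ #|C|.
Proof.
move=> cI cD s1 s2 u uD.
have Dsub i j k : {subset [:: c i; c j; c k] <= D} by move=> ?; rewrite !inE => /or3P[]/eqP->.
transitivity (\sum_i \sum_j corr (c i) (c (s i)) (c j) (c (s j))).
  under eq_bigr do rewrite expr2 mulr_suml.
  rewrite exchange_big; apply: eq_bigr => i _.
  under eq_bigr do rewrite mulr_sumr.
  by rewrite exchange_big.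
rewrite -[RHS]sumr_const; apply: eq_bigr => i _.
(* The edges that share a vertex with edge i are itself, the next and the previous one. *)
have sK := permKV s i; set k := (s^-1)%g i in sK.
have ki : k != i by rewrite -sK eq_sym s1.
have sik : s i != k by rewrite -sK s2.
have usi : uniq [:: c i; c (s i); c (s (s i))].
  by rewrite /= !inE !(inj_eq cI) negb_or ![i == _]eq_sym s1 s2 eq_sym s1.
have uk : uniq [:: c k; c i; c (s i)].
  by rewrite /= !inE !(inj_eq cI) negb_or ki [k == _]eq_sym sik eq_sym s1.
rewrite (bigD1 i) //= (bigD1 (s i)) ?s1 //= (bigD1 k) ?ki 1?eq_sym //=.
rewrite big1 ?addr0 => [|j /andP[/andP[ji jsi] jk]].
  have [-> ->] := corr_path usi u (Dsub _ _ _) uD.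
  have -> : corr (c i) (c (s i)) (c k) (c (s k)) = corr (c k) (c i) (c i) (c (s i)).
    by rewrite sK /corr; apply: eq_bigr => t _; rewrite mulrC.
  by have [-> _] := corr_path uk u (Dsub _ _ _) uD; rewrite mulr2n.
apply: corr_disjoint => [|w]; last by rewrite !inE => /or4P[]/eqP->.
rewrite /= !inE !(inj_eq cI) (inj_eq perm_inj) !negb_or !andbT.
have sji : i != s j.
  by apply: contraNneq jk => e; rewrite -(inj_eq (@perm_inj _ s)) sK -e.
by rewrite [i == s i]eq_sym s1 [i == j]eq_sym ji sji [s i == j]eq_sym jsi [j == s j]eq_sym s1.
Qed.

End SecondMoment.

Section TwoBlocks.
Variables (T : finType) (D1 D2 : {set T}) (ell : T -> T -> T -> T -> int).
Hypothesis dis : [disjoint D1 & D2].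
Hypothesis ellNl : forall x y z w, uniq [:: x; y; z; w] -> ell y x z w = - ell x y z w.
Hypothesis ellNr : forall x y z w, uniq [:: x; y; z; w] -> ell x y w z = - ell x y z w.

(** Disjoint closed walks in [D], one for each cycle of [step]; the last two conditions say
    that each of them has at least three vertices. *)
Record closed_walk (D : {set T}) (C : finType) := ClosedWalk {
  stop :> C -> T;
  step : {perm C};
  stop_inj : injective stop;
  stop_mem : forall i, stop i \in D;
  step_neq : forall i, step i != i;
  step2_neq : forall i, step (step i) != i }.

(** Up to sign, the linking number of the images of the two walks under [s], when [ell] is the
    linking of edges. *)
Definition pair_sum (C1 C2 : finType) (c1 : closed_walk D1 C1) (c2 : closed_walk D2 C2)
    (s : {perm T}) : int :=
  \sum_i \sum_j ell (s (c1 i)) (s (c1 (step c1 i))) (s (c2 j)) (s (c2 (step c2 j))).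

Lemma int_no_torsion (a : int) : a = - a -> a = 0. Proof. lia. Qed.

Lemma perm_on_fix (D D' : {set T}) (tau : {perm T}) x :
  [disjoint D & D'] -> perm_on D tau -> x \in D' -> tau x = x.
Proof. by move=> d tD xD'; apply: (out_perm tD); rewrite (disjointFl d). Qed.

Lemma walk_triple (D : {set T}) C (c : closed_walk D C) i :
  uniq [:: c i; c (step c i); c (step c (step c i))] /\
  {subset [:: c i; c (step c i); c (step c (step c i))] <= D}.
Proof.
split; last by move=> z; rewrite !inE => /or3P[]/eqP->; exact: stop_mem.
rewrite /= !inE !(inj_eq (@stop_inj _ _ c)) (inj_eq perm_inj) negb_or !andbT.
by rewrite ![i == _]eq_sym step_neq step2_neq.
Qed.

Lemma uniq4_blocks (s : {perm T}) x y z w : x \in D1 -> y \in D1 -> z \in D2 -> w \in D2 ->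
  x != y -> z != w -> uniq [:: s x; s y; s z; s w].
Proof.
move=> x1 y1 z2 w2 xy zw; rewrite /= !inE !(inj_eq perm_inj) !negb_or xy zw !andbT /=.
have ne a b : a \in D1 -> b \in D2 -> a != b.
  by move=> a1 b2; apply: contraTneq a1 => ->; rewrite (disjointFl dis).
by rewrite !ne.
Qed.

(** The second moment is proportional to the length of the walk. *)
Lemma moment_left (C1 C1' C2 : finType) (i0 : C1)
    (c1 : closed_walk D1 C1) (c1' : closed_walk D1 C1') (c2 : closed_walk D2 C2) :
  (\sum_s pair_sum c1 c2 s ^+ 2) *+ #|C1'| = (\sum_s pair_sum c1' c2 s ^+ 2) *+ #|C1|.
Proof.
pose H (s : {perm T}) x y := \sum_j ell (s x) (s y) (s (c2 j)) (s (c2 (step c2 j))).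
have equi tau s x y : perm_on D1 tau -> x \in D1 -> y \in D1 ->
    H (tau * s)%g x y = H s (tau x) (tau y).
  move=> tD _ _; apply: eq_bigr => j _; rewrite !permM.
  by rewrite !(perm_on_fix dis tD (stop_mem c2 _)).
have anti s x y : x \in D1 -> y \in D1 -> x != y -> H s y x = - H s x y.
  move=> xD yD xy; rewrite /H -sumrN; apply: eq_bigr => j _; apply: ellNl.
  by apply: uniq4_blocks => //; rewrite ?stop_mem ?(inj_eq (@stop_inj _ _ c2)) // eq_sym step_neq.
have [u uD] := walk_triple c1 i0.
have E := second_moment equi anti int_no_torsion _ _ _ _ u uD.
rewrite [in LHS](E _ _ _ (@stop_inj _ _ c1) (stop_mem c1) (step_neq c1) (step2_neq c1)).
rewrite [in RHS](E _ _ _ (@stop_inj _ _ c1') (stop_mem c1') (step_neq c1') (step2_neq c1')).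
by rewrite mulrnAC.
Qed.

Lemma moment_right (C1 C2 C2' : finType) (j0 : C2)
    (c1 : closed_walk D1 C1) (c2 : closed_walk D2 C2) (c2' : closed_walk D2 C2') :
  (\sum_s pair_sum c1 c2 s ^+ 2) *+ #|C2'| = (\sum_s pair_sum c1 c2' s ^+ 2) *+ #|C2|.
Proof.
pose H (s : {perm T}) z w := \sum_i ell (s (c1 i)) (s (c1 (step c1 i))) (s z) (s w).
have equi tau s x y : perm_on D2 tau -> x \in D2 -> y \in D2 ->
    H (tau * s)%g x y = H s (tau x) (tau y).
  move=> tD _ _; apply: eq_bigr => j _; rewrite !permM.
  by have d := dis; rewrite disjoint_sym in d; rewrite !(perm_on_fix d tD (stop_mem c1 _)).
have anti s x y : x \in D2 -> y \in D2 -> x != y -> H s y x = - H s x y.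
  move=> xD yD xy; rewrite /H -sumrN; apply: eq_bigr => j _; apply: ellNr.
  by apply: uniq4_blocks => //; rewrite ?stop_mem ?(inj_eq (@stop_inj _ _ c1)) // eq_sym step_neq.
have [u uD] := walk_triple c2 j0.
have E := second_moment equi anti int_no_torsion _ _ _ _ u uD.
have swap C (c : closed_walk D2 C) s :
    pair_sum c1 c s = \sum_j H s (c j) (c (step c j)) by rewrite /pair_sum exchange_big.
under eq_bigr do rewrite swap; under [in RHS]eq_bigr do rewrite swap.
rewrite [in LHS](E _ _ _ (@stop_inj _ _ c2) (stop_mem c2) (step_neq c2) (step2_neq c2)).
rewrite [in RHS](E _ _ _ (@stop_inj _ _ c2') (stop_mem c2') (step_neq c2') (step2_neq c2')).
by rewrite mulrnAC.
Qed.

End TwoBlocks.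

(** * The second moment for triangles and the bound *)

Lemma odd_sum_squares (s : seq int) :
  ((\sum_(a <- s) a)%:~R : bool) = true -> 1 <= \sum_(a <- s) a ^+ 2.
Proof.
elim: s => [|a s IH]; first by rewrite !big_nil.
rewrite !big_cons intrD => H.
have s0 : 0 <= \sum_(a <- s) a ^+ 2 by apply: sumr_ge0 => b _; exact: sqr_ge0.
have [a0|a0] := eqVneq a 0; first by move: H; rewrite a0 add0r => /IH; rewrite expr0n add0r.
have a1 : 1 <= a ^+ 2 by rewrite -gtz0_ge1 exprn_even_gt0.
by apply: le_trans a1 _; rewrite lerDl.
Qed.

Section Triangles.
Variables (R : realType) (V : finType) (g : rel V) (f : spatial_embedding R g).
Hypothesis g_complete : forall x y, x != y -> g x y.
Variables (xs : seq V) (x0 : V).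
Hypotheses (uxs : uniq xs) (sxs : size xs = 6%N).
Local Notation v := (nth x0 xs).

Definition triangle_link_at (idx : seq nat) (s : {perm V}) : int :=
  let w k := s (v (nth 0%N idx k)) in
  trilink f (w 0) (w 1) (w 2) (w 3) (w 4) (w 5).

Lemma triangle_link_at_moment idx : perm_eq idx (iota 0 6) ->
  \sum_s triangle_link_at idx s ^+ 2 = \sum_s triangle_link_at (iota 0 6) s ^+ 2.
Proof.
move=> pis; have ui : uniq idx by rewrite (perm_uniq pis) iota_uniq.
have szi : size idx = 6%N by rewrite (perm_size pis).
have lt6 k : k \in idx -> (k < 6)%N by rewrite (perm_mem pis) mem_iota.
have u' : uniq [seq v k | k <- idx].
  by rewrite map_inj_in_uniq // => a b /lt6 a6 /lt6 b6 /eqP; rewrite nth_uniq ?sxs // => /eqP.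
have sz' : size xs = size [seq v k | k <- idx] by rewrite size_map szi.
have inT (s : seq V) : {subset s <= [set: V]%SET} by move=> z _; rewrite finset.in_setT.
have [tau _ mt] := perm_on_extend uxs u' sz' (inT _) (inT _).
have E k : (k < 6)%N -> tau (v k) = v (nth 0%N idx k).
  move=> k6; rewrite -(nth_map x0 x0 tau) ?sxs // mt (nth_map 0%N) ?szi //.
rewrite [RHS](reindex_inj (mulgI tau)); apply: eq_bigr => s _ /=.
by rewrite /triangle_link_at /= !permM !E.
Qed.

(** The permutations of six positions that give the ten splittings into two triangles, in
    the order of [trilinks_sum_odd]. *)
Definition ten_splits : seq (seq nat) :=
  [:: [:: 0; 1; 2; 3; 4; 5]; [:: 0; 3; 2; 1; 4; 5]; [:: 0; 4; 2; 3; 1; 5];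
      [:: 0; 5; 2; 3; 4; 1]; [:: 0; 1; 3; 2; 4; 5]; [:: 0; 1; 4; 3; 2; 5];
      [:: 0; 1; 5; 3; 4; 2]; [:: 0; 3; 4; 1; 2; 5]; [:: 0; 3; 5; 1; 4; 2];
      [:: 0; 4; 5; 3; 1; 2]]%N.

(** An odd sum of integers has a nonzero term. *)
Lemma triangle_link_at_lower s : 1 <= \sum_(idx <- ten_splits) triangle_link_at idx s ^+ 2.
Proof.
have us : uniq (map s xs) by rewrite map_inj_uniq //; exact: perm_inj.
have ss : size (map s xs) = 6%N by rewrite size_map.
have := trilinks_sum_odd f g_complete (s x0) us ss.
rewrite -(big_map (fun idx => triangle_link_at idx s) predT (fun a => a ^+ 2)) => H.
apply: odd_sum_squares; rewrite -[RHS]H big_map !big_cons big_nil addr0 !addrA.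
by rewrite /triangle_link_at /= !(nth_map x0) ?sxs.
Qed.

Lemma triangle_moment :
  (#|{perm V}|%:R : int) <= (\sum_s triangle_link_at (iota 0 6) s ^+ 2) *+ 10.
Proof.
have -> : (\sum_s triangle_link_at (iota 0 6) s ^+ 2) *+ 10
        = \sum_s \sum_(idx <- ten_splits) triangle_link_at idx s ^+ 2.
  rewrite exchange_big /= [RHS](eq_big_seq (fun=> \sum_s triangle_link_at (iota 0 6) s ^+ 2)).
    by rewrite !big_cons big_nil !mulrS mulr0n.
  by move=> idx h; apply: triangle_link_at_moment; move: idx h; apply/allP.
rewrite -sumr_const; apply: ler_sum => s _; exact: triangle_link_at_lower.
Qed.

End Triangles.

Lemma ordS_perm_neq m (m3 : (3 <= m)%N) (i : 'I_m) :
  perm (@ordS_inj m) i != i /\ perm (@ordS_inj m) (perm (@ordS_inj m) i) != i.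
Proof.
rewrite !permE -!(inj_eq val_inj) /=; case: i => i im /=.
have [e|ne] := eqVneq i.+1 m.
  by rewrite e modnn modn_small; lia.
rewrite (@modn_small i.+1 m); last lia.
split; first lia.
have [e|ne'] := eqVneq i.+2 m; first by rewrite e modnn; lia.
by rewrite modn_small; lia.
Qed.

Definition cyclic_walk (T : finType) (D : {set T}) m (m3 : (3 <= m)%N) (b : 'I_m -> T)
    (bI : injective b) (bD : forall i, b i \in D) : closed_walk D 'I_m :=
  ClosedWalk bI bD (fun i => (ordS_perm_neq m3 i).1) (fun i => (ordS_perm_neq m3 i).2).

Lemma codom_pairs m (T : eqType) (b : 'I_m -> T) :
  zip (codom b) (rot 1 (codom b)) = [seq (b i, b (ordS i)) | i <- enum 'I_m].
Proof.
case: m b => [|m] b; first by rewrite /codom /image_mem enum_ord0.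
set x0 := b ord0.
apply: (@eq_from_nth _ (x0, x0)); first by rewrite size_zip size_rot minnn !size_map.
move=> i; rewrite size_zip size_rot minnn size_codom card_ord => im.
rewrite nth_zip ?size_rot // (nth_map ord0) ?size_enum_ord //.
have N k : (k < m.+1)%N -> nth x0 (codom b) k = b (inord k).
  move=> km; rewrite (nth_map ord0) ?size_enum_ord //; congr (b _); apply: val_inj.
  by rewrite /= nth_enum_ord // inordK.
have -> : nth ord0 (enum 'I_m.+1) i = inord i.
  by apply: val_inj; rewrite /= nth_enum_ord // inordK.
rewrite N //; congr (_, _).
have [x [s cE]] : exists x s, codom b = x :: s.
  by move: (size_codom b); case: (codom b) => [|x s]; rewrite card_ord // => _; exists x, s.
have sz : size s = m by have := size_codom b; rewrite cE card_ord => -[].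
rewrite cE rot1_cons nth_rcons sz.
have [im'|] := ltnP i m.
  have := N i.+1; rewrite ltnS cE => /(_ im') /= ->; congr (b _); apply: val_inj => /=.
  by rewrite !inordK // modn_small.
move=> mi; have -> : i = m by lia.
rewrite eqxx; have := N 0%N isT; rewrite cE /= => ->; congr (b _); apply: val_inj => /=.
by rewrite !inordK // modnn.
Qed.

Lemma sum_codom_pairs m (T : eqType) (b : 'I_m -> T) (F : T * T -> int) :
  \sum_(e <- zip (codom b) (rot 1 (codom b))) F e = \sum_i F (b i, b (ordS i)).
Proof. by rewrite codom_pairs big_map big_enum. Qed.

Section Average.
Variables (R : realType) (p q : nat).
Hypotheses (hp : (3 <= p)%N) (hq : (3 <= q)%N).
Local Notation V := 'I_(p + q).
Variable f : spatial_embedding R (@complete_graph (p + q)).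

Definition left_block : {set V} := finset (fun x : V => (x < p)%N).
Definition right_block : {set V} := finset (fun x : V => (p <= x)%N).

Lemma blocks_disjoint : [disjoint left_block & right_block].
Proof.
by apply/pred0P => x /=; rewrite !finset.inE; case: ltnP.
Qed.

Lemma lshift_left (i : 'I_p) : lshift q i \in left_block.
Proof. by rewrite finset.inE /=. Qed.
Lemma rshift_right (j : 'I_q) : rshift p j \in right_block.
Proof. by rewrite finset.inE /= leq_addr. Qed.

Definition left_cycle := cyclic_walk hp (@lshift_inj p q) lshift_left.
Definition right_cycle := cyclic_walk hq (@rshift_inj p q) rshift_right.

Lemma left3_inj : injective (fun i : 'I_3 => lshift q (widen_ord hp i)).
Proof. by move=> i j /lshift_inj /(congr1 val) /= ij; apply: val_inj. Qed.
Lemma right3_inj : injective (fun i : 'I_3 => rshift p (widen_ord hq i)).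
Proof. by move=> i j /rshift_inj /(congr1 val) /= ij; apply: val_inj. Qed.

Definition left_triangle := cyclic_walk (leqnn 3) left3_inj (fun i => lshift_left _).
Definition right_triangle := cyclic_walk (leqnn 3) right3_inj (fun i => rshift_right _).

Lemma complete_disjoint (x y z w : V) : uniq [:: x; y; z; w] ->
  edges_disjoint (@complete_graph (p + q)) x y z w.
Proof.
rewrite /= !inE !negb_or !andbT => /and3P[/and3P[xy xz xw] /andP[yz yw] zw].
rewrite /edges_disjoint /complete_graph xy zw disjoint_has /= !inE.
by rewrite (negbTE xz) (negbTE xw) (negbTE yz) (negbTE yw).
Qed.

Let ellNl (x y z w : V) : uniq [:: x; y; z; w] -> edge_link f y x z w = - edge_link f x y z w.
Proof. by move=> /complete_disjoint; exact: edge_link_swapl. Qed.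
Let ellNr (x y z w : V) : uniq [:: x; y; z; w] -> edge_link f x y w z = - edge_link f x y z w.
Proof. by move=> /complete_disjoint; exact: edge_link_swapr. Qed.

Local Notation psum := (pair_sum (edge_link f)).

(** The second moment is proportional to the lengths of both cycles, and triangles have
    length three. *)
Lemma cycles_vs_triangles :
  (\sum_s psum left_cycle right_cycle s ^+ 2) *+ 9
  = (\sum_s psum left_triangle right_triangle s ^+ 2) *+ (p * q).
Proof.
have i0 : 'I_p by exact: (Ordinal (ltn_trans (isT : (0 < 2)%N) hp)).
have j0 : 'I_q by exact: (Ordinal (ltn_trans (isT : (0 < 2)%N) hq)).
have := moment_left blocks_disjoint ellNl i0 left_cycle left_triangle right_cycle.
have := moment_right blocks_disjoint ellNr j0 left_triangle right_cycle right_triangle.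
rewrite !card_ord => Er El.
by rewrite (mulrnA _ 3 3) El mulrnAC Er -mulrnA mulnC.
Qed.

Definition six_vertices : seq V := [seq left_triangle i | i <- enum 'I_3] ++
                          [seq right_triangle i | i <- enum 'I_3].

Lemma six_vertices_uniq : uniq six_vertices.
Proof.
rewrite cat_uniq; apply/and3P; split.
- by rewrite map_inj_uniq ?enum_uniq //; exact: left3_inj.
- apply/hasPn => x /mapP[j _ ->]; apply/negP => /mapP[i _ /eqP].
  by rewrite eq_sym eq_lrshift.
- by rewrite map_inj_uniq ?enum_uniq //; exact: right3_inj.
Qed.

Lemma triangles_link_at x0 s :
  psum left_triangle right_triangle s = triangle_link_at f six_vertices x0 (iota 0 6) s.
Proof.
rewrite /pair_sum /triangle_link_at /trilink !big_ord_recl !big_ord0 !(big_cons, big_nil) /=.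
rewrite /six_vertices !enum_ordSl enum_ord0 /= !permE.
have S0 : ordS ord0 = lift ord0 ord0 :> 'I_3 by apply: val_inj.
have S1 : ordS (lift ord0 ord0) = lift ord0 (lift ord0 ord0) :> 'I_3 by apply: val_inj.
have S2 : ordS (lift ord0 (lift ord0 ord0)) = ord0 :> 'I_3 by apply: val_inj.
by rewrite !S2 !S1 !S0.
Qed.

Lemma cycle_lk (s : {perm V}) :
  exists2 l, l \in Gamma (@complete_graph (p + q)) p q &
  lk f l.1 l.2 = - (psum left_cycle right_cycle s)%:~R.
Proof.
pose c1 := [tuple s (lshift q i) | i < p]; pose c2 := [tuple s (rshift p j) | j < q].
have E1 : c1 = codom (fun i => s (lshift q i)) :> seq V by [].
have E2 : c2 = codom (fun i => s (rshift p i)) :> seq V by [].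
have cyc m (b : 'I_m -> V) : (3 <= m)%N -> injective b ->
    is_cycle (@complete_graph (p + q)) (codom b).
  move=> m3 bI; rewrite /is_cycle size_codom card_ord m3 /=.
  have uc : uniq (codom b) by rewrite map_inj_uniq ?enum_uniq.
  rewrite uc andbT; move: (size_codom b) uc; rewrite card_ord.
  case: (codom b) => [|x [|y t]] //= sz; first by rewrite -sz in m3.
  rewrite rcons_path => /andP[xt yt]; have xy : x != y.
    by apply: contraNneq xt => ->; rewrite inE eqxx.
  rewrite {1}/complete_graph xy /=; apply/andP; split; last first.
    by apply: contraNneq xt => <-; rewrite mem_last.
  by have := @pairwise_sorted _ (@complete_graph (p + q)) (y :: t); apply; rewrite -uniq_pairwise.
have I1 : injective (fun i => s (lshift q i)) by move=> i j /perm_inj/lshift_inj.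
have I2 : injective (fun i => s (rshift p i)) by move=> i j /perm_inj/rshift_inj.
have C1 := cyc _ _ hp I1; have C2 := cyc _ _ hq I2.
have D : [disjoint codom (fun i => s (lshift q i)) & codom (fun i => s (rshift p i))].
  apply/pred0P => x /=; apply/negbTE/negP => /andP[/codomP[i ->] /codomP[j /perm_inj/eqP]].
  by rewrite eq_lrshift.
exists (c1, c2); first by rewrite finset.inE /= E1 E2 C1 C2.
rewrite /= E1 E2 (lk_edge_link f C1 C2 D) sum_codom_pairs.
congr (- _%:~R); apply: eq_bigr => i _; rewrite sum_codom_pairs.
by apply: eq_bigr => j _; rewrite /left_cycle /right_cycle /= !permE.
Qed.

End Average.

Lemma bound_of_moments (R : realDomainType) (X Y : int) (a N : nat) (m : R) :
  (0 < N)%N -> X *+ 9 = Y *+ a -> (N%:R : int) <= Y *+ 10 -> X%:~R <= m *+ N ->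
  a%:R <= 90%:R * m.
Proof.
move=> N0 XY NY XM; rewrite -(ler_pM2l (_ : 0 < N%:R)) ?ltr0n //.
have XY' : X%:~R * 9%:R = Y%:~R * a%:R :> R by rewrite !mulr_natr -!rmorphMn XY.
have NY' : N%:R <= Y%:~R * 10%:R :> R.
  by move: NY; rewrite -(ler_int R) [X in _ <= X]rmorphMn rmorph_nat mulr_natr.
rewrite -mulr_natr in XM; have := ler_wpM2r (ler0n R a) NY'.
move: XY' XM; move: (a%:R) (X%:~R) (Y%:~R) (N%:R) => b x y k; lra.
Qed.

(** Every permutation of the vertices gives a pair of cycles in [Gamma], so that the mean
    of the squares is at most [M ^+ 2]; and it is p q / 9 times the mean for two triangles,
    which is at least 1 / 10. *)
Lemma pq_le_90_bound_sq (R : realType) (p q : nat) (hp : (3 <= p)%N) (hq : (3 <= q)%N)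
    (f : spatial_embedding R (@complete_graph (p + q))) (M : R) :
  (forall l, l \in Gamma (@complete_graph (p + q)) p q -> `|lk f l.1 l.2| <= M) ->
  (p * q)%:R <= 90%:R * M ^+ 2.
Proof.
move=> bound.
pose X := \sum_s pair_sum (edge_link f) (left_cycle q hp) (right_cycle p hq) s ^+ 2.
pose Y := \sum_s pair_sum (edge_link f) (left_triangle q hp) (right_triangle p hq) s ^+ 2.
pose N := #|{perm 'I_(p + q)}|.
have XY : X *+ 9 = Y *+ (p * q) by exact: cycles_vs_triangles.
have NY : (N%:R : int) <= Y *+ 10.
  have cg (x y : 'I_(p + q)) : x != y -> @complete_graph (p + q) x y by [].
  have := triangle_moment f cg (left_triangle q hp ord0) (six_vertices_uniq hp hq).
  rewrite /Y; under [in X in _ -> X]eq_bigr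
    do rewrite (triangles_link_at hp hq f (left_triangle q hp ord0)).
  by apply; rewrite size_cat !size_map -!enumT size_enum_ord.
have XM : X%:~R <= M ^+ 2 *+ N.
  rewrite /X rmorph_sum -sumr_const; apply: ler_sum => s _ /=.
  have [l lG lE] := cycle_lk hp hq f s.
  have := bound l lG; rewrite lE normrN => h.
  by rewrite rmorphXn /= -real_normK ?num_real // ler_sqr ?nnegrE // (le_trans _ h).
have N0 : (0 < N)%N by apply/card_gt0P; exists 1%g.
exact: bound_of_moments N0 XY NY XM.
Qed.

Theorem corollary1p8 (R : realType) (n p q : nat)
    (hn : (6 <= n)%N) (hp : (3 <= p)%N) (hq : (3 <= q)%N) (hpq : n = (p + q)%N)
    (f : spatial_embedding R (@complete_graph n)) :
  \big[Num.max/0]_(l in Gamma (@complete_graph n) p q) `|lk f l.1 l.2|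
    >= Num.sqrt (p * q)%:R / (3%:R * Num.sqrt 10%:R).
Proof.
subst n; set M := \big[_/_]_(_ in _) _.
have M0 : 0 <= M by exact: bigmax_ge_id.
have := @pq_le_90_bound_sq R p q hp hq f M (fun l lG => le_bigmax_cond _ _ lG).
move=> H; have s10 : 0 < Num.sqrt 10%:R :> R by rewrite sqrtr_gt0 ltr0n.
rewrite ler_pdivrMr ?mulr_gt0 ?ltr0n //.
rewrite -(@ler_pXn2r _ 2) ?nnegrE ?sqrtr_ge0 ?mulr_ge0 ?ler0n ?(ltW s10) //.
rewrite !exprMn !sqr_sqrtr ?ler0n //; apply: le_trans H _.
by lra.
Qed.
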